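(* Suppose each block gives the same reward $w>0$, and let $s=p\,q\,n$ be the expected number of solutions per round. Let $t\in\{1,\dots,n-1\}$ and let $t'$ be a positive integer with $t'<\min\{n/2,\,t+1\}$. Let $\delta'\in(0,1)$ and $\delta''>0$. Then for all $\epsilon,\epsilon'\ge 0$ with $$\epsilon+\epsilon'<\frac{t'}{n-t'}(1-\delta')-\frac{t'}{n}(1+\delta'')(1+s),$$ Bitcoin with fixed target in a synchronous setting is not a $(t,\epsilon,\epsilon')$-EVP according to the utility function relative rewards, $U^j_T(\mathcal E)=R^j_T(\mathcal E)/R^j_S(\mathcal E)$ if $R^j_S(\mathcal E)\ne 0$ and $U^j_T(\mathcal E)=0$ otherwise.
   Context: Execution model. $\kappa$ is the security parameter. There are $n$ participants $S=\{P_1,\dots,P_n\}$, an environment $\mathcal Z$ and an adversary $\mathcal A$, all probabilistic polynomial-time (PPT) interactive machines; a control program enforces the rules below. The execution proceeds in synchronous rounds; in each round the environment activates the participants in round-robin order and the adversary is able to act after the honest participants. There is one oracle, a random oracle modelling a hash function: each participant may ask at most $q$ queries per round, and each query independently succeeds (yields a valid block extending the chain being worked on, called a solution) with probability $p$. The parameters $n,q,p$ (and block rewards) are fixed, and the target (hence $p$) does not change. Messages are sent through a Diffuse functionality: the adversary sees the messages of honest participants during the round and may delay them until the end of the round, so it may deliver its own messages first (to recipients of its choice); at the end of each round every honest participant has received all messages sent by all other honest participants. An environment is $r$-admissible if it is PPT, gets input $1^{p'(\kappa)}$ for a polynomial $p'$, and runs the protocol for $r=\pi(\kappa)\neq 0$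 rounds, $\pi$ a (nonconstant) polynomial, after which it terminates the execution. Bitcoin with fixed target. Each participant keeps a local chain of blocks. An honest participant adopts the longest chain it has received, in case of a tie the one received first (so the adversary's block is always preferred in a tie); in each round it asks all its $q$ queries trying to extend its chain, even after finding a block; if it finds more than one block in a round it sends only the first one; if it receives a block in the middle of a round it does not change what it is extending until the round ends. (An adversarial coalition that deviates is not bound by these rules; in particular it may extend a block it found within the same round and withhold blocks.) Adversaries. A static adversary controls, from the beginning, a set $T\subseteq S$ of participants; participants outside $T$ follow the protocol (''honest''). A static adversary with fixed cost chooses at the beginning $T$ and, for each controlled participant $P_{i_m}$, the number $q-x_m$ (with $0\le x_m\le q$) of queries that participant asks in every round; otherwise its strategy is arbitrary. $H_T$ is the adversary that controls $T$ and follows the protocol (asking all $q$ queries per participant per round), except that it delivers its messages first when several solutions are produced in the same round. $\mathcal E_{\mathcal Z,\mathcal A}$ denotes the random execution with environment $\mathcal Z$ and adversary $\mathcal A$. Rewards and utility. For $P_j\in S\setminus T$, $R^j_T(\mathcal E)$ (respectively $R^j_S(\mathcal E)$) is the total reward of the blocks produced by participants in $T$ (respectively in $S$) that are in the local chain of $P_j$ after the last complete round $r$ of $\mathcal E$. Given a utility $U^j_T$ defined for each $P_j\in S\setminus T$, put $U^{\max}_T=\max_{P_j\in S\setminus T}U^j_T$ and $U^{\min}_T=\min_{P_j\in S\setminus T}U^j_T$. EVP. The protocol is a $(t,\epsilon,\epsilon')$-equilibrium with virtual payoffs (EVP) according to $\{U^j_T\}$ if for every PPT static adversary with fixed cost $\mathcal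 A$ controlling a set $T$ of at most $t$ participants and every $r$-admissible environment $\mathcal Z$, $$U^{\max}_T(\mathcal E'_{\mathcal Z,\mathcal A})\le U^{\min}_T(\mathcal E_{\mathcal Z,H_T})+\epsilon\,|U^{\min}_T(\mathcal E_{\mathcal Z,H_T})|+\epsilon'$$ with overwhelming probability in $\kappa$ (i.e. except with probability negligible in $\kappa$), where $\mathcal E_{\mathcal Z,H_T}$ and $\mathcal E'_{\mathcal Z,\mathcal A}$ are independent executions with the same environment $\mathcal Z$. *)

(* Defs.v *)
From HB Require Import structures.
From mathcomp Require Import all_boot all_order all_algebra.
From mathcomp Require Import reals.
Set Implicit Arguments.
Unset Strict Implicit.
Unset Printing Implicit Defensive.
Import Order.TTheory GRing.Theory Num.Theory.
Local Open Scope ring_scope.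

(* Random experiments: [Flip b k] tosses a fresh coin that shows [true] with
   probability [b], independently of all other tosses. *)
Inductive rand (R : realType) (A : Type) : Type :=
| Ret of A
| Flip of R & (bool -> rand R A).
Arguments Ret {R A}.
Arguments Flip {R A}.

Fixpoint bind (R : realType) (A B : Type) (m : rand R A) (f : A -> rand R B)
    : rand R B :=
  match m with
  | Ret a => f a
  | Flip b k => Flip b (fun c => bind (k c) f)
  end.

Notation "'let*' x ':=' m 'in' f" := (bind m (fun x => f))
  (at level 200, x name, m at level 100, f at level 200).
Notation "'let*' ( x , y ) ':=' m 'in' f" := (bind m (fun '(x, y) => f))
  (at level 200, x name, y name, m at level 100, f at level 200).

Fixpoint pr (R : realType) (A : Type) (E : A -> bool) (m : rand R A) : R :=
  match m with
  | Ret a => (E a)%:R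
  | Flip b k => b * pr E (k true) + (1 - b) * pr E (k false)
  end.

Fixpoint surely (R : realType) (A : Type) (E : A -> Prop) (m : rand R A)
    : Prop :=
  match m with
  | Ret a => E a
  | Flip _ k => surely E (k true) /\ surely E (k false)
  end.

Fixpoint foldM (R : realType) (S A : Type) (f : S -> A -> rand R S) (s : S)
    (l : seq A) : rand R S :=
  if l is a :: l' then let* s' := f s a in foldM f s' l' else Ret s.

Definition independent (R : realType) (A B : Type) (m1 : rand R A)
    (m2 : rand R B) : rand R (A * B) :=
  let* a := m1 in let* b := m2 in Ret (a, b).

Definition negligible (R : realType) (f : nat -> R) : Prop :=
  forall c : nat, exists k0 : nat,
  forall k : nat, (k0 <= k)%N -> `|f k| < (k%:R ^+ c)^-1.

Definition overwhelming (R : realType) (f : nat -> R) : Prop :=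
  negligible (fun k => 1 - f k).

(* Interactive probabilistic multitape Turing machines.  [None] is the blank.
   Tapes are infinite in both directions: [Tape l r] has the head on the first
   cell of [r], and [l] lists the cells on its left, nearest first. *)
Record tape := Tape { ltape : seq (option bool); rtape : seq (option bool) }.

Inductive dir := MoveL | MoveN | MoveR.

Definition tread (t : tape) : option bool := head None (rtape t).

Definition tmove (t : tape) (a : option bool) (d : dir) : tape :=
  let r := behead (rtape t) in
  match d, ltape t with
  | MoveN, l => Tape l (a :: r)
  | MoveR, l => Tape (a :: l) r
  | MoveL, b :: l => Tape l (b :: a :: r)
  | MoveL, [::] => Tape [::] (None :: a :: r)
  end.

(* [tm_delta] receives a fair coin at each step and returns [None] to end the
   current activation. Tape 0 is the input tape, tape 1 the output tape. *)
Record machine := Machine {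
  tm_work : nat;
  tm_state : finType;
  tm_start : tm_state;
  tm_delta : tm_state -> {ffun 'I_tm_work.+2 -> option bool} -> bool ->
    option (tm_state * {ffun 'I_tm_work.+2 -> option bool * dir}) }.

Definition tapes (M : machine) := 'I_(tm_work M).+2 -> tape.

Definition blank (M : machine) : tapes M := fun=> Tape [::] [::].
Arguments blank : clear implicits.

Definition load (M : machine) (c : tapes M) (w : seq bool) : tapes M :=
  fun i => if i == 0%N :> nat then Tape [::] (map Some w)
           else if i == 1%N :> nat then Tape [::] [::]
           else c i.

Definition unload (M : machine) (c : tapes M) : seq bool :=
  let t := c (inord 1) in pmap id (catrev (ltape t) (rtape t)).

Definition tm_step (M : machine) (z : tm_state M) (c : tapes M) (b : bool)
    : option (tm_state M * tapes M) :=
  if tm_delta z [ffun i => tread (c i)] b is Some (z', a)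
  then Some (z', fun i => tmove (c i) (a i).1 (a i).2) else None.

(* [None] means that the machine has not stopped within [fuel] steps. *)
Fixpoint run (R : realType) (M : machine) (fuel : nat) (z : tm_state M)
    (c : tapes M) : rand R (option (tapes M)) :=
  if fuel is fuel'.+1 then
    Flip 2^-1 (fun b =>
      if tm_step z c b is Some (z', c') then run R fuel' z' c'
      else Ret (Some c))
  else Ret None.

Definition activate (R : realType) (M : machine) (fuel : nat) (c : tapes M)
    (w : seq bool) : rand R (option (tapes M)) :=
  run R fuel (tm_start M) (load c w).

(* On every sequence of inputs [ws] and for all coins, every activation stops
   within [clock L] steps, where [L] is the total length of the inputs received
   up to and including that activation ([L0] before the first of [ws]). *)
Fixpoint timely (R : realType) (M : machine) (clock : nat -> nat)
    (c : tapes M) (L0 : nat) (ws : seq (seq bool)) : Prop :=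
  if ws is w :: ws' then
    let L := (L0 + size w)%N in
    surely (fun o : option (tapes M) =>
              if o is Some c' then timely R clock c' L ws' else False)
           (activate R (clock L) c w)
  else True.

(* One activation of a machine with memory: the state is the tapes together
   with the total input length so far.  For a machine that is [timely] for
   [clock] the default value is never used, and the result does not depend on
   which such clock is chosen. *)
Definition respond (R : realType) (M : machine) (clock : nat -> nat)
    (m : tapes M * nat) (w : seq bool)
    : rand R (seq bool * (tapes M * nat)) :=
  let L := (m.2 + size w)%N in
  let* o := activate R (clock L) m.1 w in
  Ret (if o is Some c then (unload c, (c, L)) else ([::], (m.1, L))).

Definition boot (R : realType) (M : machine) (clock : nat -> nat)
    (w : seq bool) : rand R (tapes M * nat) :=
  let* (y, m) := @respond R M clock (blank M, 0%N) w in Ret m.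
Arguments timely R M clock c L0 ws : clear implicits.
Arguments respond R M clock m w : clear implicits.
Arguments boot R M clock w : clear implicits.

(* A chain lists its blocks, most recent first, genesis excluded. *)
Record block (n : nat) := Block { producer : 'I_n; contents : seq bool }.
Notation chain n := (seq (block n)).

(* All chains that exist, in order of creation and starting with the genesis
   chain [::].  A chain is designated by its position in this list, which plays
   the role of the hash of its last block; positions out of range designate the
   genesis chain. *)
Notation pool n := (seq (chain n)).
Notation chain_at P i := (nth [::] P i).

(* Longest chain rule, ties being resolved in favour of the first received. *)
Definition adopt (n : nat) (P : pool n) (current : nat) (inbox : seq nat)
    : nat :=
  foldl (fun c i => if (size (chain_at P c) < size (chain_at P i))%N
                    then i else c) current inbox.

(* What the control program tells the adversary. *)
Inductive signal (n : nat) : Type :=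
| Seen of nat & nat & block n  (* an honest participant sends chain [i], which
                                  extends chain [k] by the block [b] *)
| Input of 'I_n & seq bool     (* the environment activates controlled [P_j];
                                  the reply is the output of [P_j] *)
| Query of 'I_n                (* [P_j] asks a query; the reply is [1^i 0 c]:
                                  extend chain [i] by a block with contents
                                  [c] *)
| Result of 'I_n & option nat  (* outcome of that query *)
| Deliver.                     (* the reply is [1^j1 0 1^i1 0 1^j2 0 1^i2 0 ..]:
                                  deliver chain [i1] to [P_j1], and so on *)
Arguments Deliver {n}.

Definition enc_nat (i : nat) : seq bool := nseq i true ++ [:: false].
Definition enc_bits (w : seq bool) : seq bool :=
  flatten [seq [:: true; b] | b <- w] ++ [:: false].
Definition enc_block (n : nat) (b : block n) : seq bool :=
  enc_nat (producer b) ++ enc_bits (contents b).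
Definition enc_chain (n : nat) (C : chain n) : seq bool :=
  flatten [seq true :: enc_block b | b <- C] ++ [:: false].
Definition enc_signal (n : nat) (s : signal n) : seq bool :=
  match s with
  | Seen i k b => enc_nat 0 ++ enc_nat i ++ enc_nat k ++ enc_block b
  | Input j x => enc_nat 1 ++ enc_nat j ++ enc_bits x
  | Query j => enc_nat 2 ++ enc_nat j
  | Result j None => enc_nat 3 ++ enc_nat j
  | Result j (Some i) => enc_nat 4 ++ enc_nat j ++ enc_nat i
  | Deliver => enc_nat 5
  end.

Definition dec_query (w : seq bool) : nat * seq bool :=
  (index false w, drop (index false w).+1 w).

Fixpoint dec_nats (acc : nat) (w : seq bool) : seq nat :=
  match w with
  | true :: w' => dec_nats acc.+1 w'
  | false :: w' => acc :: dec_nats 0 w'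
  | [::] => [::]
  end.
Fixpoint pair_up (s : seq nat) : seq (nat * nat) :=
  if s is j :: i :: s' then (j, i) :: pair_up s' else [::].
Definition dec_deliveries (w : seq bool) : seq (nat * nat) :=
  pair_up (dec_nats 0 w).

(* Behaviour of an adversary, not necessarily given by a machine.  The pool it
   is shown contains nothing but its own chains and those honest participants
   have sent. *)
Record strategy (R : realType) (n : nat) := Strategy {
  mind : Type;
  start : nat -> rand R mind;
  react : mind -> pool n -> signal n -> rand R (seq bool * mind) }.

(* Static adversary with fixed cost: [adv_idle A m] is the number x_m of queries
   per round that the controlled participant [P_m] does not ask. *)
Record adversary (n q : nat) := Adversary {
  adv_machine : machine;
  adv_clock : {poly nat};
  adv_idle : {ffun 'I_n -> 'I_q.+1} }.

Definition ppt_adversary (R : realType) (n q : nat) (A : adversary n q)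
    : Prop :=
  forall (k : nat) (ws : seq (seq bool)),
    timely R (adv_machine A) (fun L => (adv_clock A).[L])
           (blank (adv_machine A)) 0%N (nseq k true :: ws).

Definition adv_strategy (R : realType) (n q : nat) (A : adversary n q)
    : strategy R n :=
  let clock L := (adv_clock A).[L] in
  {| mind := tapes (adv_machine A) * nat;
     start k := boot R (adv_machine A) clock (nseq k true);
     react m _ s := respond R (adv_machine A) clock m (enc_signal s) |}.

(* The control program counts the rounds: it stops the execution after
   [env_rounds Z k] of them. *)
Record environment := Environment {
  env_machine : machine;
  env_clock : {poly nat};
  env_input : nat -> nat;
  env_rounds : nat -> nat }.

Definition agrees_with (f : nat -> nat) (P : {poly rat}) : Prop :=
  forall k : nat, (f k)%:R = P.[k%:R].

(* Each activation of the environment is bounded by a polynomial in the security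
   parameter alone, whatever it receives: if it could depend on the length of
   the adversary's messages, the two together could run for exponential time. *)
Definition admissible (R : realType) (Z : environment) : Prop :=
  [/\ exists P : {poly rat}, agrees_with (env_input Z) P,
      exists2 P : {poly rat}, (1 < size P)%N & agrees_with (env_rounds Z) P,
      forall k, env_rounds Z k <> 0%N
    & forall (k : nat) (ws : seq (seq bool)),
        timely R (env_machine Z) (fun=> (env_clock Z).[k])
               (blank (env_machine Z)) 0%N (nseq (env_input Z k) true :: ws)].

(* The adversary that follows the protocol on behalf of [T], except that its
   messages are delivered before those of the other participants. *)
Record honest_mind (n : nat) := HonestMind {
  h_head : 'I_n -> nat;          (* local chains of the participants in [T] *)
  h_input : 'I_n -> seq bool;
  h_found : seq ('I_n * nat);    (* the first block found by each, this round *)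
  h_seen : seq nat }.            (* chains sent by the others, this round *)

Definition follow (R : realType) (n : nat) (T : {set 'I_n}) : strategy R n :=
  {| mind := honest_mind n;
     start _ := Ret (HonestMind (fun=> 0%N) (fun=> [::]) [::] [::]);
     react m P s :=
       let: HonestMind hd inp found seen := m in
       Ret match s with
       | Seen i _ _ => ([::], HonestMind hd inp found (rcons seen i))
       | Input j x =>
           (enc_chain (chain_at P (hd j)),
            HonestMind hd (fun i => if i == j then x else inp i) found seen)
       | Query j => (enc_nat (hd j) ++ inp j, m)
       | Result j o =>
           ([::], if o is Some i then
                    if j \in unzip1 found then m
                    else HonestMind hd inp (rcons found (j, i)) seen
                  else m)
       | Deliver =>
           (flatten [seq enc_nat (j : 'I_n) ++ enc_nat i
                    | i <- unzip2 found, j <- enum (~: T)],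
            HonestMind (fun j => adopt P (hd j) (unzip2 found ++ seen))
                       inp [::] [::])
       end |}.

Record world (n : nat) (ZS AS : Type) := World {
  chains : pool n;
  local : 'I_n -> nat;  (* local chains; meaningful for honest participants *)
  sent : seq nat;       (* chains sent by honest participants this round *)
  said : seq bool;      (* output of the participant activated last *)
  zmem : ZS;
  amem : AS }.

(* The participant asks all of its queries, even after a success. *)
Fixpoint mine (R : realType) (p : R) (queries : nat) : rand R bool :=
  if queries is k.+1 then
    Flip p (fun b => let* b' := mine p k in Ret (b || b'))
  else Ret false.

Definition activate_participant (R : realType) (n q : nat) (p : R)
    (ZS : Type) (Z : ZS -> seq bool -> rand R (seq bool * ZS))
    (A : strategy R n) (T : {set 'I_n})
    (s : world n ZS (mind A)) (j : 'I_n) : rand R (world n ZS (mind A)) :=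
  let: World P loc snt y z a := s in
  let* (x, z') := Z z y in
  if j \in T then
    let* (y', a') := react a P (Input j x) in
    Ret (World P loc snt y' z' a')
  else
    let y' := enc_chain (chain_at P (loc j)) in
    let* found := mine p q in
    if found then
      let b := Block j x in
      let P' := rcons P (b :: chain_at P (loc j)) in
      let* (r, a') := react a P' (Seen (size P) (loc j) b) in
      Ret (World P' loc (rcons snt (size P)) y' z' a')
    else Ret (World P loc snt y' z' a).
Arguments activate_participant {R n} q p {ZS} Z A T s j.

Definition adversarial_query (R : realType) (n : nat) (p : R) (ZS : Type)
    (A : strategy R n) (s : world n ZS (mind A)) (j : 'I_n)
    : rand R (world n ZS (mind A)) :=
  let: World P loc snt y z a := s in
  let* (w, a') := react a P (Query j) in
  let: (i, c) := dec_query w in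
  Flip p (fun success =>
    let P' := if success then rcons P (Block j c :: chain_at P i) else P in
    let o := if success then Some (size P) else None in
    let* (r, a'') := react a' P' (Result j o) in
    Ret (World P' loc snt y z a'')).
Arguments adversarial_query {R n} p {ZS} A s j.

(* Every honest participant, including the producer of a block, considers what
   the adversary delivers before the chains sent by honest participants in this
   round; the adversary may thus win all ties, and it may also reorder the
   honest chains by delivering them itself. *)
Definition end_of_round (R : realType) (n : nat) (ZS : Type)
    (A : strategy R n) (T : {set 'I_n}) (s : world n ZS (mind A))
    : rand R (world n ZS (mind A)) :=
  let: World P loc snt y z a := s in
  let* (w, a') := react a P Deliver in
  let inbox (j : 'I_n) :=
    [seq d.2 | d <- dec_deliveries w & d.1 == j :> nat] ++ snt in
  Ret (World P (fun j => if j \in T then loc j else adopt P (loc j) (inbox j))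
             [::] y z a').
Arguments end_of_round {R n ZS} A T s.

Definition round (R : realType) (n q : nat) (p : R)
    (ZS : Type) (Z : ZS -> seq bool -> rand R (seq bool * ZS))
    (A : strategy R n) (T : {set 'I_n}) (idle : {ffun 'I_n -> 'I_q.+1})
    (s : world n ZS (mind A)) : rand R (world n ZS (mind A)) :=
  let* s1 := foldM (activate_participant q p Z A T) s (enum 'I_n) in
  let* s2 := foldM (adversarial_query p A) s1
             (flatten [seq nseq (q - idle j) j | j <- enum T]) in
  end_of_round A T s2.
Arguments round {R n q} p {ZS} Z A T idle s.

(* Only the local chains after the last round are kept. *)
Definition outcome (n : nat) := 'I_n -> chain n.

Definition execution (R : realType) (n q : nat) (p : R) (Z : environment)
    (A : strategy R n) (T : {set 'I_n}) (idle : {ffun 'I_n -> 'I_q.+1})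
    (k : nat) : rand R (outcome n) :=
  let clock := fun=> (env_clock Z).[k] in
  let* z := boot R (env_machine Z) clock (nseq (env_input Z k) true) in
  let* a := start A k in
  let* s := foldM (fun s _ => round p (respond R (env_machine Z) clock) A T
                                           idle s)
            (World [:: [::]] (fun=> 0%N) [::] [::] z a)
            (iota 0 (env_rounds Z k)) in
  Ret (fun j => chain_at (chains s) (local s j)).

(* Utilities U^j_T of the coalition [T] according to the honest [P_j]. *)
Definition utility (R : realType) (n : nat) :=
  {set 'I_n} -> 'I_n -> outcome n -> R.

(* Maximum and minimum over a nonempty set. *)
Definition max_over (R : realType) (n : nat) (S : {set 'I_n}) (f : 'I_n -> R)
    : R :=
  if [pick i in S] is Some i0 then \big[Num.max/f i0]_(i in S) f i else 0.
Definition min_over (R : realType) (n : nat) (S : {set 'I_n}) (f : 'I_n -> R)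
    : R :=
  if [pick i in S] is Some i0 then \big[Num.min/f i0]_(i in S) f i else 0.

Definition EVP (R : realType) (n q : nat) (p : R) (t : nat) (eps eps' : R)
    (U : utility R n) : Prop :=
  forall (T : {set 'I_n}) (A : adversary n q) (Z : environment),
    (#|T| <= t)%N -> ppt_adversary R A -> admissible R Z ->
    let Umax E := max_over (~: T) (fun j => U T j E) in
    let Umin E := min_over (~: T) (fun j => U T j E) in
    overwhelming (fun k =>
      pr (fun e : outcome n * outcome n =>
            Umax e.2 <= Umin e.1 + eps * `|Umin e.1| + eps')
         (independent
            (execution p Z (follow R T) T
                       ([ffun=> ord0] : {ffun 'I_n -> 'I_q.+1}) k)
            (execution p Z (adv_strategy R A) T (adv_idle A) k))).

Definition reward (R : realType) (n : nat) (w : R) (T : {set 'I_n}) (j : 'I_n)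
    (E : outcome n) : R :=
  \sum_(b <- E j | producer b \in T) w.

Definition relative_rewards (R : realType) (n : nat) (w : R) : utility R n :=
  fun T j E =>
    if reward w [set: 'I_n] j E != 0
    then reward w T j E / reward w [set: 'I_n] j E else 0.

(* Main.v *)
Require Import Defs.
From HB Require Import structures.
From mathcomp Require Import all_boot all_order all_algebra.
From mathcomp Require Import reals.
From mathcomp Require Import zify ring lra.
Set Implicit Arguments.
Unset Strict Implicit.
Unset Printing Implicit Defensive.
Import Order.TTheory GRing.Theory Num.Theory.

(** The coalition T, with t' members, mines selfishly. It withholds its blocks,
    and in each round in which an honest block appears it releases the oldest
    withheld block, which wins the tie; only when nothing is withheld does an
    honest block survive, and then T extends it. Let N and L be the number of
    blocks of T and of all blocks in the public chain, and d the number of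
    withheld blocks. For a < t'/(n-t') and D large enough,
    N - a L + D (1 - (1 - 1/D)^d) grows in expectation by a positive constant
    in each round: the last summand is a bounded and slowly varying substitute
    for d, whose drift is that of N + d - a L while d is small. When T is
    honest instead, b L - N grows in expectation by a positive constant in each
    round if b > (t'/n)(1+s).

    No concentration is needed. As N - a L is at most the number of rounds and
    has an expectation linear in that number, it is positive with probability
    bounded away from 0; likewise for b L - N. The two executions being
    independent, the inequality of an equilibrium fails with probability
    bounded away from 0. *)

(** * A selfish miner as a Turing machine *)

Notation sym := (option bool).

(* [tmove] makes blank cells explicit, so tapes are compared up to trailing
   blanks on both sides. *)
Definition tape_eq (t u : tape) : Prop :=
  nth None (ltape t) =1 nth None (ltape u) /\
  nth None (rtape t) =1 nth None (rtape u).

Lemma tape_eq_trans t u v : tape_eq t u -> tape_eq u v -> tape_eq t v.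
Proof. by move=> [h1 h2] [h3 h4]; split=> i; rewrite ?h1 ?h2. Qed.

Lemma tread_eq t u : tape_eq t u -> tread t = tread u.
Proof. by case=> _ h; rewrite /tread -!nth0 h. Qed.

Lemma nth_cons_eq (T : Type) (x0 x : T) s s' :
  nth x0 s =1 nth x0 s' -> nth x0 (x :: s) =1 nth x0 (x :: s').
Proof. by move=> h [|i] //=. Qed.

Lemma tmoveL l r a :
  tmove (Tape l r) a MoveL = Tape (behead l) (head None l :: a :: behead r).
Proof. by case: l. Qed.

Lemma tmove_eq t u a d : tape_eq t u -> tape_eq (tmove t a d) (tmove u a d).
Proof.
case: t u => [lt rt] [lu ru] [/= hl hr].
have hb : nth None (behead rt) =1 nth None (behead ru).
  by move=> i; rewrite !nth_behead.
case: d; rewrite ?tmoveL /=; split=> //=; try by apply: nth_cons_eq.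
- by move=> i; rewrite !nth_behead.
- by rewrite -!nth0 hl; do 2!apply: nth_cons_eq.
Qed.

Lemma tmove_stay t : tape_eq (tmove t (tread t) MoveN) t.
Proof. by case: t => l [|x r]; split=> //=; case=> //= i; rewrite nth_nil. Qed.

Lemma tape_eq_padr l r k : tape_eq (Tape l (r ++ nseq k None)) (Tape l r).
Proof.
split=> //= i; rewrite nth_cat; case: ltnP => // h.
by rewrite nth_nseq if_same nth_default.
Qed.

Lemma tape_eq_padl l r k : tape_eq (Tape (l ++ nseq k None) r) (Tape l r).
Proof.
split=> //= i; rewrite nth_cat; case: ltnP => // h.
by rewrite nth_nseq if_same nth_default.
Qed.

Lemma pmap_nth_eq (s s' : seq sym) :
  nth None s =1 nth None s' -> pmap id s = pmap id s'.
Proof.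
elim: s s' => [|x s IH] s'.
  elim: s' => [|y s' IH'] //= h; have /= <- := h 0%N.
  by apply: IH' => i; have /= <- := h i.+1; rewrite !nth_nil.
case: s' => [|y s'] h.
  have /= -> := h 0%N.
  by rewrite (IH [::]) // => i; have /= -> := h i.+1; rewrite !nth_nil.
have /= -> := h 0%N.
by rewrite /= (IH s') // => i; have /= -> := h i.+1.
Qed.

Lemma pmap_rev (s : seq sym) : pmap id (rev s) = rev (pmap id s).
Proof.
elim: s => // -[b|] s IH /=; rewrite rev_cons -cats1 pmap_cat /= IH ?cats0 //.
by rewrite rev_cons cats1.
Qed.

Lemma unload_eq (M : machine) (c : tapes M) t :
  tape_eq (c (inord 1)) t ->
  unload c = rev (pmap id (ltape t)) ++ pmap id (rtape t).
Proof.
rewrite /unload => -[h1 h2].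
by rewrite catrevE pmap_cat pmap_rev (pmap_nth_eq h1) (pmap_nth_eq h2).
Qed.

(* The labels of the control states. [Tag] counts the leading ones of the
   signal; [Chk] tests whether the queue is empty; [Skip] skips one number of
   the signal and [App] appends the next one to the queue and the tip tape;
   [Ql] and [Qr] write the tip; [Prog], [Copy] and [Rew] write the deliveries;
   [Del] erases the front of the queue and [Go] returns to its end. *)
Inductive label :=
  Tag | Chk | Skip | App | Ql | Qr | Prog | Copy | Rew | Del | Go.

Definition label_ord (l : label) : 'I_11 :=
  inord match l with
  | Tag => 0 | Chk => 1 | Skip => 2 | App => 3 | Ql => 4 | Qr => 5 | Prog => 6
  | Copy => 7 | Rew => 8 | Del => 9 | Go => 10
  end.
Definition ord_label (i : 'I_11) : label :=
  nth Go [:: Tag; Chk; Skip; App; Ql; Qr; Prog; Copy; Rew; Del] i.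
Lemma label_ordK : cancel label_ord ord_label.
Proof. by case; rewrite /ord_label inordK. Qed.

HB.instance Definition _ := Finite.copy label (can_type label_ordK).

(* The deliveries of one chain to everyone; [None] is a hole for its index. *)
Definition delivery_prog (n : nat) : seq sym :=
  flatten [seq rcons (map Some (enc_nat j)) None | j <- iota 0 n].

Notation action := (option (sym * dir)).

(* Tape 2 holds the queue of withheld chains as [1^u1 0 1^u2 0 ..], with the
   head behind it; tape 3 ends with the unary index of the private chain, with
   the head behind it; the cell of tape 4 tells whether an honest block has
   appeared in this round. [None] in the list of actions leaves a tape alone.
   The counter [k] is used by [Tag], and by [Prog], [Copy] and [Rew] as a
   position in [prog]. *)
Definition selfish_delta (prog : seq sym) (l : label) (k : nat)
    (x qu ti fl : sym) : option (label * nat * seq action) :=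
  let advance := Some (x, MoveR) in
  match l with
  | Tag =>
    match x with
    | Some true => if (k < 6)%N then Some (Tag, k.+1, [:: advance]) else None
    | None => None
    | Some false =>
      match k with
      | 0 => if fl is Some true then None
             else Some (Chk, 0%N, [:: advance; None; Some (qu, MoveL); None;
                                      Some (Some true, MoveN)])
      | 2 => Some (Ql, 0%N, [:: None; None; None; Some (ti, MoveL)])
      | 4 => Some (Skip, 0%N, [:: advance])
      | 5 => if fl is Some true then
               Some (Rew, 0%N, [:: None; None; Some (qu, MoveL); None;
                                   Some (None, MoveN)])
             else None
      | _ => None
      end
    end
  | Chk =>
    if qu is Some _ then Some (Go, 0%N, [:: None; None; Some (qu, MoveR)])
    else Some (App, 0%N, [:: None; None; Some (qu, MoveR);
                             Some (Some false, MoveR)])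
  | Skip =>
    match x with
    | Some true => Some (Skip, 0%N, [:: advance])
    | Some false => Some (App, 0%N, [:: advance; None; None;
                                        Some (Some false, MoveR)])
    | None => None
    end
  | App =>
    if x is Some true then
      Some (App, 0%N, [:: advance; None; Some (Some true, MoveR);
                          Some (Some true, MoveR)])
    else Some (Go, 0%N, [:: None; None; Some (Some false, MoveR)])
  | Ql =>
    if ti is Some true then
      Some (Ql, 0%N, [:: None; Some (Some true, MoveR); None; Some (ti, MoveL)])
    else
      Some (Qr, 0%N, [:: None; Some (Some false, MoveR); None;
                         Some (ti, MoveR)])
  | Qr =>
    if ti is Some true then
      Some (Qr, 0%N, [:: None; None; None; Some (ti, MoveR)])
    else None
  | Prog =>
    match ohead (drop k prog) with
    | Some (Some b) => Some (Prog, k.+1, [:: None; Some (Some b, MoveR)])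
    | Some None => Some (Copy, k.+1, [::])
    | None => Some (Del, 0%N, [::])
    end
  | Copy =>
    if qu is Some true then
      Some (Copy, k, [:: None; Some (Some true, MoveR); Some (qu, MoveR)])
    else Some (Rew, k, [:: None; Some (Some false, MoveR); Some (qu, MoveL)])
  | Rew =>
    if qu is Some _ then Some (Rew, k, [:: None; None; Some (qu, MoveL)])
    else Some (Prog, k, [:: None; None; Some (qu, MoveR)])
  | Del =>
    if qu is Some true then Some (Del, 0%N, [:: None; None; Some (None, MoveR)])
    else Some (Go, 0%N, [:: None; None; Some (None, MoveR)])
  | Go =>
    if qu is Some _ then Some (Go, 0%N, [:: None; None; Some (qu, MoveR)])
    else None
  end.

(** The coin is ignored. The counter must reach 6 for the tag and the length of [prog] for the
    deliveries, and [size prog + 6] bounds both. A missing action rewrites the symbol read without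
    moving. *)
Definition selfish_machine (n : nat) : machine :=
  let prog := delivery_prog n in
  {| tm_work := 3;
     tm_state := (label * 'I_(size prog + 6).+1)%type;
     tm_start := (Tag, ord0);
     tm_delta := fun z f _ =>
       let: (l, k) := z in
       let rd i := f (inord i) in
       if selfish_delta prog l k (rd 0%N) (rd 2) (rd 3) (rd 4)
         is Some (l', k', acts)
       then Some ((l', inord k'),
                  [ffun i => odflt (f i, MoveN) (nth None acts i)])
       else None |}.

(** * Symbolic execution and running time *)

Notation blank_tape := (Tape [::] [::]).

Definition represents n (c : tapes (selfish_machine n)) (v : seq tape) :=
  forall i, tape_eq (c i) (nth blank_tape v i).

Definition act (a : action) (t : tape) : tape :=
  if a is Some (x, d) then tmove t x d else t.

Definition acts_on (acts : seq action) (v : seq tape) : seq tape :=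
  [seq act (nth None acts i) (nth blank_tape v i) | i <- iota 0 5].

Section Halting.
Variables (R : realType) (n : nat).
Notation prog := (delivery_prog n).
Implicit Types (Post : tapes (selfish_machine n) -> Prop).

(** Total correctness in continuation style: [Post] concerns the final halt, so each loop below
    takes the specification of what follows as a premise and adds its own steps to [m]. *)
Definition halts (m : nat) (l : label) (k : nat) (v : seq tape) Post : Prop :=
  forall c, represents c v -> forall fuel, (m <= fuel)%N ->
  surely (fun o => exists2 c', o = Some c' & Post c')
    (run R fuel ((l, inord k) : tm_state (selfish_machine n)) c).

Lemma halts_eq m l k v v' Post :
  (forall i, tape_eq (nth blank_tape v i) (nth blank_tape v' i)) ->
  halts m l k v' Post -> halts m l k v Post.
Proof. move=> h hv c hc; apply: hv => i; exact: tape_eq_trans (hc i) (h i). Qed.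

Lemma halts_le m m' l k v Post :
  (m' <= m)%N -> halts m' l k v Post -> halts m l k v Post.
Proof. by move=> h hv c hc f hf; apply: hv => //; apply: leq_trans hf. Qed.

Let reading v (i : nat) := tread (nth blank_tape v i).

Lemma tm_step_selfish l k c v b :
  (k < (size prog + 6).+1)%N -> represents c v ->
  match selfish_delta prog l k (reading v 0) (reading v 2) (reading v 3)
          (reading v 4) with
  | Some (l', k', acts) =>
    exists2 c', tm_step ((l, inord k) : tm_state (selfish_machine n)) c b =
                  Some ((l', inord k'), c') & represents c' (acts_on acts v)
  | None => tm_step ((l, inord k) : tm_state (selfish_machine n)) c b = None
  end.
Proof.
move=> hk hc; rewrite /tm_step /= inordK // !ffunE.
have rd i : (i < 5)%N -> tread (c (inord i)) = reading v i.
  by move=> hi; rewrite (tread_eq (hc _)) inordK.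
rewrite !rd //; case: selfish_delta => [[[l' k'] acts]|] //.
eexists; first reflexivity.
move=> i; rewrite /acts_on (nth_map 0) ?size_iota // nth_iota // add0n !ffunE.
case: (nth None acts i) => [[x d]|] /=; first exact: tmove_eq.
exact: tape_eq_trans (tmove_stay _) (hc i).
Qed.

Lemma halts_stop m l k v Post : (k < (size prog + 6).+1)%N ->
  selfish_delta prog l k (reading v 0) (reading v 2) (reading v 3)
    (reading v 4) = None ->
  (forall c, represents c v -> Post c) -> halts m.+1 l k v Post.
Proof.
move=> hk hd hp c hc [|f] // _.
have h b := tm_step_selfish l b hk hc; rewrite hd in h.
by split; rewrite h /=; exists c => //; apply: hp.
Qed.

Lemma halts_step m l k v l' k' acts Post : (k < (size prog + 6).+1)%N ->
  selfish_delta prog l k (reading v 0) (reading v 2) (reading v 3)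
    (reading v 4) = Some (l', k', acts) ->
  halts m l' k' (acts_on acts v) Post -> halts m.+1 l k v Post.
Proof.
move=> hk hd hp c hc [|f] // hf.
have h b := tm_step_selfish l b hk hc; rewrite hd in h.
by split; [case: (h true)|case: (h false)] => c' -> hc' /=; apply: hp.
Qed.

Arguments tmove : simpl never.

Lemma tmoveR l r a : tmove (Tape l r) a MoveR = Tape (a :: l) (behead r).
Proof. by []. Qed.

Lemma tmoveN l r a : tmove (Tape l r) a MoveN = Tape l (a :: behead r).
Proof. by []. Qed.

Lemma nseq_cat_cons (T : Type) i (x : T) l :
  nseq i x ++ x :: l = x :: nseq i x ++ l.
Proof. by elim: i => //= i ->. Qed.

(** All configurations met have this shape: the output is only appended to, and tape 4 has one cell
    in use. *)
Let V x o qu ti fl := [:: x; Tape o [::]; qu; ti; Tape [::] [:: fl]].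

Ltac hstep :=
  apply: halts_step;
  [ try by lia | by rewrite /reading /= ?tmoveL /tread /=; reflexivity
  | rewrite /acts_on /= ?tmoveL ?tmoveR ?tmoveN /=].

Section Loops.
Variables (Post : tapes (selfish_machine n) -> Prop) (fl : sym).

Lemma halts_go m (s : seq bool) x o l ti : (size s < m)%N ->
  (forall c, represents c (V x o (Tape (rev (map Some s) ++ l) [::]) ti fl) ->
     Post c) ->
  halts m Go 0 (V x o (Tape l (map Some s)) ti fl) Post.
Proof.
elim: s m l => [|b s IH] [|m] l //= hm h.
  by apply: halts_stop => //; lia.
hstep; apply: IH; first by lia.
by move=> c hc; apply: h; rewrite rev_cons cat_rcons.
Qed.

(** [index false s] is the size of [s] if no zero occurs, so a number cut off by the end of the
    signal is read like a terminated one. *)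
Lemma halts_app m (s : seq bool) lx o l lt : ((size s).+1 < m)%N ->
  (forall c x, represents c
     (V x o (Tape (Some false :: nseq (index false s) (Some true) ++ l) [::])
        (Tape (nseq (index false s) (Some true) ++ lt) [::]) fl) -> Post c) ->
  halts m App 0 (V (Tape lx (map Some s)) o (Tape l [::]) (Tape lt [::]) fl)
    Post.
Proof.
elim: s m lx l lt => [|[] s IH] [|m] lx l lt //= hm h.
- hstep; apply: (@halts_go _ [::]) => [|c hc] /=; [by lia|exact: h hc].
- hstep; apply: IH; first by lia.
  by move=> c x hc; apply: (h c x); rewrite -!nseq_cat_cons.
- hstep; apply: (@halts_go _ [::]) => [|c hc] /=; [by lia|exact: h hc].
Qed.

Lemma halts_skip m (s : seq bool) lx o qu lt :
  (false \notin s ->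
     forall c x, represents c (V x o qu (Tape lt [::]) fl) -> Post c) ->
  (false \in s -> forall lx,
     halts m App 0 (V (Tape lx (map Some (drop (index false s).+1 s))) o qu
                      (Tape (Some false :: lt) [::]) fl) Post) ->
  halts (size s + m).+1 Skip 0
    (V (Tape lx (map Some s)) o qu (Tape lt [::]) fl) Post.
Proof.
elim: s lx => [|[] s IH] lx /= h happ.
- by apply: halts_stop => [|//|c]; [lia|exact: h].
- by hstep; apply: IH.
- hstep; apply: (@halts_le _ m); first by lia.
  by rewrite drop0 in happ; apply: happ.
Qed.

Lemma halts_tag m k (s : seq bool) lx o qu ti : (k <= 6)%N ->
  ((false \notin s) || (6 < k + index false s)%N ->
     forall c x, represents c (V x o qu ti fl) -> Post c) ->
  (false \in s -> (k + index false s <= 6)%N -> forall lx,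
     halts m Tag (k + index false s)
       (V (Tape lx (map Some (drop (index false s) s))) o qu ti fl) Post) ->
  halts (size s + m).+1 Tag k (V (Tape lx (map Some s)) o qu ti fl) Post.
Proof.
elim: s k lx => [|[] s IH] k lx hk /= h htag.
- by apply: halts_stop => [|//|c]; [lia|exact: h].
- case: (leqP 6 k) => hk6.
    apply: halts_stop; first by lia.
      by rewrite /reading /= ltnNge hk6.
    by move=> c; apply: h; lia.
  apply: halts_step; first by lia.
    by rewrite /reading /= hk6; reflexivity.
  by apply: IH => //; rewrite addSnnS.
- apply: (@halts_le _ m); first by lia.
  by rewrite addn0 in htag; apply: htag.
Qed.

(** Earlier indices stay on the tip tape; the loop ends at the cell in front of the last one, which
    by hypothesis is not a one. *)
Lemma halts_ql m tip rest x o qu r :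
  head None rest <> Some true ->
  halts m Qr 0 (V x (Some false :: nseq tip (Some true) ++ o) qu
     (Tape (head None rest :: behead rest) (nseq tip (Some true) ++ r)) fl)
     Post ->
  halts (tip + m).+1 Ql 0 (V x o qu
    (Tape (behead (nseq tip (Some true) ++ rest))
          (head None (nseq tip (Some true) ++ rest) :: r)) fl) Post.
Proof.
move=> hr; elim: tip o r => [|tip IH] o r h.
  by case E: (head None rest) hr => [[]|] //= _; rewrite /= ?E in h *; hstep.
by hstep; apply: IH; rewrite !nseq_cat_cons.
Qed.

Lemma halts_qr m tip x o qu l r : (tip < m)%N ->
  (forall c, represents c (V x o qu (Tape (nseq tip (Some true) ++ l)
     (None :: r)) fl) -> Post c) ->
  halts m Qr 0 (V x o qu (Tape l (nseq tip (Some true) ++ None :: r)) fl) Post.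
Proof.
elim: tip m l => [|tip IH] [|m] l //= hm h.
  by apply: halts_stop => //; lia.
by hstep; apply: IH => // c; rewrite nseq_cat_cons; apply: h.
Qed.

Lemma halts_rew m k (s : seq bool) x o r ti : (k <= size prog)%N ->
  halts m Prog k (V x o (Tape [::] (rev (map Some s) ++ r)) ti fl) Post ->
  halts (size s + m).+1 Rew k
    (V x o (Tape (behead (map Some s)) (head None (map Some s) :: r)) ti fl)
    Post.
Proof.
move=> hk; elim: s r => [|b s IH] r h.
  hstep; apply: halts_eq h => -[|[|[|i]]] //=; exact: (@tape_eq_padl [::] r 1).
by hstep; apply: IH; rewrite rev_cons cat_rcons in h.
Qed.

Lemma halts_copy m k i x o l r ti : (k <= size prog)%N ->
  halts m Rew k (V x (Some false :: nseq i (Some true) ++ o)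
    (Tape (behead (nseq i (Some true) ++ l))
          (head None (nseq i (Some true) ++ l) :: Some false :: r)) ti fl)
    Post ->
  halts (i + m).+1 Copy k
    (V x o (Tape l (nseq i (Some true) ++ Some false :: r)) ti fl) Post.
Proof.
move=> hk; elim: i o l => [|i IH] o l h; first by hstep.
by hstep; apply: IH; rewrite !nseq_cat_cons.
Qed.

Lemma halts_hole m k i x o s ti : (k <= size prog)%N ->
  let qu := Tape [::] (map Some (enc_nat i ++ s)) in
  halts m Prog k (V x (rev (map Some (enc_nat i)) ++ o) qu ti fl) Post ->
  halts (i + (i + m).+1).+1 Copy k (V x o qu ti fl) Post.
Proof.
move=> hk /= h.
have e1 : map Some (enc_nat i) = rcons (nseq i (Some true)) (Some false).
  by rewrite map_cat map_nseq cats1.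
rewrite map_cat e1 cat_rcons in h *; apply: halts_copy => //.
have e2 : nseq i (Some true) = map Some (nseq i true) by rewrite map_nseq.
rewrite cats0 {2 3}e2; have := halts_rew (s := nseq i true); rewrite size_nseq.
apply=> //; by rewrite -e2 rev_nseq; rewrite rev_rcons rev_nseq in h.
Qed.

Definition fill (i : nat) (s : seq sym) : seq bool :=
  flatten [seq if y is Some b then [:: b] else enc_nat i | y <- s].

(** A hole costs most: one step to reach [Copy], then [i + 1] steps for copying and [i + 1] for
    rewinding, hence the factor [2 * i + 3]. *)
Lemma halts_prog m k i x o s ti : (k <= size prog)%N ->
  let qu := Tape [::] (map Some (enc_nat i ++ s)) in
  halts m Del 0 (V x (rev (map Some (fill i (drop k prog))) ++ o) qu ti fl)
    Post ->
  halts (size (drop k prog) * (2 * i + 3) + m).+1 Prog k (V x o qu ti fl) Post.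
Proof.
move=> hk; move E: (drop k prog) => w.
elim: w k E o hk => [|y w IH] k E o hk /= h.
  by apply: halts_step; [lia|rewrite /= E; reflexivity|].
have hk' : (k < size prog)%N.
  by rewrite ltnNge; apply/negP => /drop_oversize; rewrite E.
have E2 : drop k.+1 prog = w by rewrite -add1n -drop_drop E /= drop0.
case: y E h => [b|] E h.
  apply: halts_step; [lia|rewrite /= E; reflexivity|].
  apply: (@halts_le _ (size w * (2 * i + 3) + m).+1); first by nia.
  by apply: IH => //; rewrite /= rev_cons cat_rcons in h.
apply: halts_step; [lia|rewrite /= E; reflexivity|].
apply: (@halts_le _ (i + (i + (size w * (2 * i + 3) + m).+1).+1).+1).
  by nia.
apply: halts_hole => //; apply: IH => //.
by rewrite catA -rev_cat -map_cat.
Qed.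

Lemma halts_del m i x o l r ti :
  halts m Go 0 (V x o (Tape (nseq i.+1 None ++ l) r) ti fl) Post ->
  halts (i + m).+1 Del 0
    (V x o (Tape l (nseq i (Some true) ++ Some false :: r)) ti fl) Post.
Proof.
elim: i l => [|i IH] l h; first by hstep.
by hstep; apply: IH; rewrite nseq_cat_cons.
Qed.

End Loops.

(** * The memory behind the tapes *)

Record memory := Memory { withheld : seq nat; tip : nat; alert : bool }.

Definition queue_bits (us : seq nat) : seq bool := flatten (map enc_nat us).

(** Anything may precede the tip on its tape, provided it does not prolong the unary number. The
    last clause is an invariant: an honest block met with an empty queue is queued itself, so a
    release always finds a chain. *)
Definition stores (c : tapes (selfish_machine n)) (s : memory) : Prop :=
  [/\ tape_eq (c (inord 2))
        (Tape (rev (map Some (queue_bits (withheld s)))) [::]),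
      exists2 l, head None l <> Some true &
        tape_eq (c (inord 3)) (Tape (nseq (tip s) (Some true) ++ l) [::]),
      tape_eq (c (inord 4))
        (Tape [::] [:: if alert s then Some true else None])
    & alert s -> withheld s <> [::] ].

(* If nothing is withheld, the first honest block of the round is queued, so
   that it is extended, and delivered at the end of the round. *)
Definition selfish_step (s : memory) (w : seq bool) : memory * seq bool :=
  let: Memory us i al := s in
  if false \notin w then (s, [::]) else
  let: (tag, w1) := dec_query w in
  match tag with
  | 0 =>
    if al then (s, [::])
    else if us is [::] then
      (Memory [:: index false w1] (index false w1) true, [::])
    else (Memory us i true, [::])
  | 2 => (s, enc_nat i)
  | 4 =>
    if false \notin w1 then (s, [::])
    else let k := index false (dec_query w1).2 in
      (Memory (rcons us k) k al, [::])
  | 5 =>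
    if (al, us) is (true, u :: us') then
      (Memory us' i false,
       flatten [seq enc_nat j ++ enc_nat u | j <- iota 0 n])
    else (s, [::])
  | _ => (s, [::])
  end.

Definition selfish_time (L : nat) : nat := ((size prog + 10) * (4 * L + 4))%N.

(** Every stored number was read from an input, so the memory is bounded by the total length of the
    inputs. Time linear in the memory thus becomes time linear in that length. *)
Definition fits (L : nat) (s : memory) : Prop :=
  (size (queue_bits (withheld s)) <= L)%N /\ (tip s <= L)%N.

Lemma size_queue_rcons us k :
  size (queue_bits (rcons us k)) = (size (queue_bits us) + k.+1)%N.
Proof.
rewrite /queue_bits map_rcons flatten_rcons size_cat size_cat size_nseq.
by rewrite addn1.
Qed.

Lemma fits_step L s w : fits L s -> fits (L + size w) (selfish_step s w).1.
Proof.
case: s => us i al [/= h1 h2].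
have h : fits (L + size w) (Memory us i al) by split=> /=; lia.
rewrite /selfish_step; case: ifPn => //; rewrite negbK => hw.
have hi : (index false w < size w)%N by rewrite index_mem.
have [/= e1 e2] : size (dec_query w).2 = (size w - (index false w).+1)%N /\
  (index false (dec_query w).2 <= size (dec_query w).2)%N.
  by split; [rewrite size_drop|exact: index_size].
rewrite /dec_query in e1 e2 *.
case: (index false w) e1 e2 hi => [|[|[|[|[|[|k]]]]]] //= e1 e2 hi.
- case: al h => // h; case: us h1 h => [|u us] h1 h //.
  by rewrite /queue_bits; split; rewrite /= ?size_cat ?size_nseq /=; lia.
- case: ifPn => //; rewrite negbK -index_mem => hw1.
  set k := index false (drop _ _).
  have hk : (k <= size (drop (index false (drop 5 w)).+1 (drop 5 w)))%N.
    exact: index_size.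
  rewrite !size_drop in hk e1 hw1.
  by split=> /=; rewrite ?size_queue_rcons; lia.
- case: al h => //; case: us h1 => [|u us] h1 h //; split=> /=; last by lia.
  by rewrite /queue_bits /= size_cat in h1; rewrite /queue_bits; lia.
Qed.

Lemma stored (c : tapes (selfish_machine n)) s out x qu ti l f :
  represents c (V x (rev (map Some out)) qu ti f) ->
  tape_eq qu (Tape (rev (map Some (queue_bits (withheld s)))) [::]) ->
  head None l <> Some true ->
  tape_eq ti (Tape (nseq (tip s) (Some true) ++ l) [::]) ->
  f = (if alert s then Some true else None) ->
  (alert s -> withheld s <> [::]) ->
  stores c s /\ unload c = out.
Proof.
move=> hc hq hl ht hf hal; split; last first.
  have := hc (inord 1); rewrite inordK //= => /(@unload_eq (selfish_machine n)).
  move=> -> /=.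
  by rewrite cats0 -map_rev map_pK // revK.
split=> //.
- by have := hc (inord 2); rewrite inordK //= => h; apply: tape_eq_trans h hq.
- exists l => //.
  by have := hc (inord 3); rewrite inordK //= => h; apply: tape_eq_trans h ht.
- by have := hc (inord 4); rewrite inordK //= hf.
Qed.

Lemma rev_queue_rcons us k :
  rev (map Some (queue_bits (rcons us k))) =
  Some false :: nseq k (Some true) ++ rev (map Some (queue_bits us)).
Proof.
rewrite /queue_bits map_rcons flatten_rcons map_cat rev_cat map_cat map_nseq.
by rewrite cats1 rev_rcons rev_nseq.
Qed.

Lemma fill_delivery_prog i :
  fill i prog = flatten [seq enc_nat j ++ enc_nat i | j <- iota 0 n].
Proof.
rewrite /delivery_prog; elim: (iota 0 n) => //= j js IH.
rewrite -{}IH /fill map_cat flatten_cat map_rcons flatten_rcons -map_comp.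
congr ((_ ++ _) ++ _).
by elim: (enc_nat j) => //= b w {2}<-.
Qed.

(** Each tag leads to a composition of the loops above. The word [w] is arbitrary, since the clock
    must also be met on words that encode no signal. *)
Lemma selfish_run c s w m L : stores c s -> fits L s ->
  (selfish_time (L + size w) <= m)%N ->
  surely (fun o => exists2 c', o = Some c' &
            stores c' (selfish_step s w).1 /\
            unload c' = (selfish_step s w).2)
    (run R m (tm_start (selfish_machine n)) (load c w)).
Proof.
case: s => us i al; set st := selfish_step _ _ => hs hfit hm.
case: hs hfit => hq [l hl ht] hf hal [hus hi].
rewrite /= in hq ht hf hal hus hi.
set f := if al then _ else _ in hf.
pose qu := Tape (rev (map Some (queue_bits us))) [::].
pose ti := Tape (nseq i (Some true) ++ l) [::].
have hc : represents (load c w) (V (Tape [::] (map Some w)) [::] qu ti f).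
  move=> j; rewrite -(inord_val j) /load; move: (ltn_ord j).
  by case: (val j) => [|[|[|[|[|k]]]]] //= _; rewrite inordK.
have -> : tm_start (selfish_machine n) = (Tag, inord 0).
  by congr pair; apply: val_inj; rewrite /= inordK.
set Q := (fun c' => stores c' st.1 /\ unload c' = st.2).
suff h : halts (selfish_time (L + size w)) Tag 0
    (V (Tape [::] (map Some w)) [::] qu ti f) Q by exact: h.
have hQ out x us' i' al' q t l' g c' : st = (Memory us' i' al', out) ->
    represents c' (V x (rev (map Some out)) q t g) ->
    tape_eq q (Tape (rev (map Some (queue_bits us'))) [::]) ->
    head None l' <> Some true ->
    tape_eq t (Tape (nseq i' (Some true) ++ l') [::]) ->
    g = (if al' then Some true else None) ->
    (al' -> us' <> [::]) -> Q c'.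
  move=> e h1 h2 h3 h4 h5 h6; rewrite /Q e.
  exact: (@stored _ (Memory us' i' al') _ _ _ _ _ _ h1 h2 h3 h4 h5 h6).
have est : st = selfish_step (Memory us i al) w by [].
clear c hq ht hf hc; clearbody Q st.
have hidle : st = (Memory us i al, [::]) ->
    forall c x, represents c (V x [::] qu ti f) -> Q c.
  by move=> e c x hc; apply: (hQ _ _ _ _ _ _ _ _ _ _ e hc _ hl).
have hS : (size w <= size w * (size prog + 10))%N by lia.
have ht3 : (3 * (L + size w) + size w + 12 <= selfish_time (L + size w))%N.
  by rewrite /selfish_time; nia.
(* Reading the tag takes at most [size w + 1] steps; the rest of the budget is left to the
   branches. *)
apply: (@halts_le _ (size w + (selfish_time (L + size w) - size w - 1)).+1).
  by lia.
have hstep_ms : (4 * (L + size w) + 4 + size prog * (4 * L + 4) <=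
   selfish_time (L + size w) - size w - 1)%N by rewrite /selfish_time; nia.
case: (_ - 1)%N hstep_ms => [|M] hM; first by lia.
apply: halts_tag => // [hnot|hw hk lx].
  apply: hidle; rewrite est /selfish_step /dec_query; case: ifPn => // hw.
  rewrite (negbTE hw) in hnot.
  by case: (index false w) hnot => [|[|[|[|[|[|k]]]]]].
rewrite (drop_index hw) add0n.
have {}hw0 : (0 < size w)%N by case: (w) hw.
have hw1 : (size (drop (index false w).+1 w) <= size w)%N.
  by rewrite size_drop leq_subr.
rewrite /selfish_step hw /dec_query in est.
move: (drop _ w) hw1 hk est => w1 hw1 hk est.
case: (index false w) hk est => [|[|[|[|[|[|[|k]]]]]]] //= _ est.
- case: al est hal @f hidle => [] est hal f hidle.
    by apply: halts_stop; [lia|by []|move=> c'; exact: (hidle est)].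
  case: us est hal @qu hus hidle => [|u us] est _ qu hus hidle.
    apply: (@halts_le _ (size w1).+4); first by lia.
    hstep; rewrite /= /qu /=; hstep.
    (* Testing the empty queue moved the head left and back, which leaves explicit blanks. *)
    apply: (@halts_eq _ _ _ _ (V (Tape (Some false :: lx) (map Some w1)) [::]
      (Tape [::] [::]) (Tape (Some false :: nseq i (Some true) ++ l) [::])
      (Some true))) => [[|[|[|j]]]|] //=.
      exact: tape_eq_trans (@tape_eq_padl [::] _ 1) (@tape_eq_padr _ [::] 1).
    apply: halts_app => // c' x hc'.
    apply: (hQ _ _ _ _ _ _ _ (Some false :: nseq i (Some true) ++ l) _ _
              est hc') => //.
    by rewrite -[[:: index _ _]]/(rcons [::] _) rev_queue_rcons.
  apply: (@halts_le _ 3); first by lia.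
  hstep; rewrite /qu /=.
  case E: (rev _) => [|y qs].
    move/(congr1 size): E.
    by rewrite size_rev size_map size_cat size_cat addn1.
  have [b hb] : exists b, y = Some b.
    have : y \in rev (map Some (queue_bits (u :: us))) by rewrite E mem_head.
    by rewrite mem_rev => /mapP [b _ ->]; exists b.
  rewrite hb in E *; hstep.
  apply: (@halts_eq _ _ _ _ (V (Tape (Some false :: lx) (map Some w1)) [::]
    qu ti (Some true))) => [[|[|[|j]]]|] //=.
    by rewrite /qu E; exact: (@tape_eq_padr _ [::] 1).
  rewrite /qu E; apply: (@halts_go _ _ _ [::]) => // c' hc'.
  by apply: (hQ _ _ _ _ _ _ _ _ _ _ est hc' _ hl) => //; rewrite E.
- by apply: halts_stop; [lia|by []|move=> c'; exact: (hidle est)].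
- apply: (@halts_le _ (i + i.+2).+2); first by lia.
  hstep; apply: halts_ql => //; apply: halts_qr => // c' hc'.
  have e : rev (map Some (enc_nat i)) =
      Some false :: nseq i (Some true) ++ [::].
    by rewrite map_cat map_nseq cats1 rev_rcons rev_nseq cats0.
  rewrite -e in hc'.
  (* The excursion of the head makes the cell in front of the tip explicit even if [l] is empty. *)
  apply: (hQ _ _ _ _ _ _ _ (head None l :: behead l) _ _ est hc') => //.
  exact: (@tape_eq_padr _ [::] 1).
- by apply: halts_stop; [lia|by []|move=> c'; exact: (hidle est)].
- apply: (@halts_le _ (size w1 + (size w1).+4).+2); first by lia.
  hstep; apply: halts_skip => [hw2|hw2 lx'].
    by move=> c' x; apply: hidle; rewrite est hw2.
  rewrite hw2 in est; apply: halts_app.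
    by have := leq_subr (index false w1).+1 (size w1); rewrite -size_drop; lia.
  move=> c' x hc'.
  apply: (hQ _ _ _ _ _ _ _ (Some false :: nseq i (Some true) ++ l) _ _ est hc')
    => //.
  - by rewrite rev_queue_rcons.
  - by case: (us).
- case: al est hal @f hidle => [] est hal f hidle; last first.
    by apply: halts_stop; [lia|by []|move=> c'; exact: (hidle est)].
  case: us est hal @qu hus hidle => [|u us] est hq' qu hus hidle.
    by case: hq'.
  have hu : (u < size (queue_bits (u :: us)))%N.
    by rewrite size_cat size_cat size_nseq addn1 leq_addr.
  set s := size prog in hM.
  have hz : (size (queue_bits us) <= size (queue_bits (u :: us)))%N.
    by rewrite [X in (_ <= X)%N]size_cat leq_addl.
  apply: (@halts_le _ (size (rev (queue_bits (u :: us))) +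
    (s * (2 * u + 3) + (u + (size (queue_bits us)).+1).+1).+1).+2).
    by rewrite size_rev; nia.
  hstep; rewrite /qu -map_rev; apply: halts_rew => //.
  rewrite map_rev revK.
  apply: (@halts_eq _ _ _ _ (V (Tape lx (Some false :: map Some w1)) [::]
    (Tape [::] (map Some (enc_nat u ++ queue_bits us))) ti None))
      => [[|[|[|j]]]|] //=.
    exact: (@tape_eq_padr _ _ 1).
  have -> : s = size (drop 0 prog) by rewrite drop0.
  apply: halts_prog => //; rewrite drop0.
  rewrite map_cat map_cat map_nseq -catA; apply: halts_del.
  apply: halts_go => // c' hc'; rewrite fill_delivery_prog !cats0 in hc'.
  apply: (hQ _ _ _ _ _ _ _ _ _ _ est hc' _ hl) => //.
  (* The erased cells are blanks at the left end of the queue. *)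
  exact: (@tape_eq_padl _ [::] u.+1).
- by apply: halts_stop; [lia|by []|move=> c'; exact: (hidle est)].
Qed.

End Halting.

Local Open Scope ring_scope.

(** * Lower bounds on expectations *)

Section LowerBounds.
Variable R : realType.

(* The expectation of [u] is at least [v], where each leaf [a] may be given any
   value [u] such that [K a u]. As [K] is a relation, these values may depend
   on data of which the leaf only has an encoding, such as the contents of the
   tapes of a machine. *)
Fixpoint attains (A : Type) (K : A -> R -> Prop) (m : rand R A) (v : R)
    : Prop :=
  match m with
  | Ret a => exists2 u, v <= u & K a u
  | Flip b k =>
    0 <= b <= 1 /\ exists v1 v2,
      [/\ attains K (k true) v1, attains K (k false) v2
        & v <= b * v1 + (1 - b) * v2]
  end.

(** A tree may carry any real weights; bounds propagate only through weights in the unit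
    interval. *)
Fixpoint calibrated (A : Type) (m : rand R A) : Prop :=
  match m with
  | Ret _ => True
  | Flip b k => [/\ 0 <= b <= 1, calibrated (k true) & calibrated (k false)]
  end.

Lemma calibrated_bind (A B : Type) (m : rand R A) (f : A -> rand R B) :
  calibrated m -> (forall a, calibrated (f a)) -> calibrated (bind m f).
Proof.
move=> + hf; elim: m => //= b k IH [hb h1 h2].
by split=> //; exact: IH.
Qed.

Lemma calibrated_run (M : machine) (fuel : nat) (z : tm_state M) (c : tapes M) :
  calibrated (run R fuel z c).
Proof.
elim: fuel z c => //= fuel IH z c; split; first by lra.
  by case: tm_step => [[]|].
by case: tm_step => [[]|].
Qed.

Lemma calibrated_respond (M : machine) clock m w :
  calibrated (respond R M clock m w).
Proof. by apply: calibrated_bind => //; apply: calibrated_run. Qed.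

Lemma calibrated_boot (M : machine) clock w : calibrated (boot R M clock w).
Proof. by apply: calibrated_bind => [|[]] //; apply: calibrated_respond. Qed.

Lemma surely_mono (A : Type) (E E' : A -> Prop) (m : rand R A) :
  (forall a, E a -> E' a) -> surely E m -> surely E' m.
Proof. by move=> h; elim: m => [a|b k IH] /=; [apply: h|case=> /IH ? /IH]. Qed.

Lemma surely_bind (A B : Type) (E : B -> Prop) (m : rand R A)
    (f : A -> rand R B) :
  surely (fun a => surely E (f a)) m -> surely E (bind m f).
Proof. by elim: m => [a|b k IH] //= [/IH ? /IH]. Qed.

Lemma surely_true (A : Type) (m : rand R A) : surely (fun=> True) m.
Proof. by elim: m => //= b k IH; split. Qed.

Lemma attains_le (A : Type) K (m : rand R A) (u v : R) :
  u <= v -> attains K m v -> attains K m u.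
Proof.
case: m => [a|b k] /= huv.
  by case=> x hx hK; exists x => //; apply: le_trans hx.
case=> hb [v1 [v2 [h1 h2 h]]]; split=> //; exists v1, v2; split=> //.
exact: le_trans h.
Qed.

Lemma attains_ret (A : Type) (K : A -> R -> Prop) a v :
  K a v -> attains K (Ret a) v.
Proof. by exists v. Qed.

Lemma attains_mono (A : Type) (K K' : A -> R -> Prop) m v :
  (forall a u, K a u -> K' a u) -> attains K m v -> attains K' m v.
Proof.
move=> hK; elim: m v => [a|b k IH] v /=.
  by case=> x hx h; exists x => //; apply: hK.
by case=> hb [v1 [v2 [/IH h1 /IH h2 h]]]; split=> //; exists v1, v2.
Qed.

(** Law of total expectation: the value given to an outer leaf is a bound for the tree grafted
    there. *)
Lemma attains_bind (A B : Type) K (m : rand R A) (f : A -> rand R B) v :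
  attains (fun a => attains K (f a)) m v -> attains K (bind m f) v.
Proof.
elim: m v => [a|b k IH] v /=; first by case=> x hx; apply: attains_le.
by case=> hb [v1 [v2 [/IH h1 /IH h2 h]]]; split=> //; exists v1, v2.
Qed.

(** A loop invariant in submartingale form: [I] relates the remaining work and the state to a bound
    on the expected final value, and each step preserves that bound in expectation. *)
Lemma attains_foldM (S A : Type) (f : S -> A -> rand R S)
    (I : seq A -> S -> R -> Prop) l s v :
  (forall a l s v, I (a :: l) s v -> attains (I l) (f s a) v) ->
  I l s v -> attains (I [::]) (foldM f s l) v.
Proof.
move=> hf; elim: l s v => [|a l IH] s v h /=; first exact: attains_ret.
by apply: attains_bind; apply: attains_mono (hf _ _ _ _ h).
Qed.

Lemma attains_surely (A : Type) (E : A -> Prop) K (m : rand R A) v :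
  calibrated m -> surely E m -> (forall a, E a -> K a v) -> attains K m v.
Proof.
move=> + + hK; elim: m => [a _ h|b k IH [hb p1 p2] [s1 s2]] /=.
  by exists v => //; apply: hK.
split=> //; exists v, v; split; [exact: IH|exact: IH|].
by rewrite -mulrDl addrC subrK mul1r.
Qed.

Lemma attains_calibrated (A : Type) K (m : rand R A) v :
  calibrated m -> (forall a, K a v) -> attains K m v.
Proof. by move=> hm hK; apply: attains_surely hm (surely_true m) _. Qed.

Lemma attains_flip (A : Type) (K : A -> R -> Prop) b (k : bool -> rand R A)
    v1 v2 v :
  0 <= b <= 1 -> attains K (k true) v1 -> attains K (k false) v2 ->
  v <= b * v1 + (1 - b) * v2 -> attains K (Flip b k) v.
Proof. by move=> hb h1 h2 h; split=> //; exists v1, v2. Qed.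

Lemma attains_affine (A : Type) (K : A -> R -> Prop) m (c d v : R) : 0 <= c ->
  attains K m v ->
  attains (fun a u => exists2 x, u = c * x + d & K a x) m (c * v + d).
Proof.
move=> hc; elim: m v => [a|b k IH] v /=.
  by case=> x hx hK; exists (c * x + d); [rewrite lerD2r ler_wpM2l|exists x].
case=> hb [v1 [v2 [/IH h1 /IH h2 h]]]; split=> //.
exists (c * v1 + d), (c * v2 + d); split=> //.
have := ler_wpM2l hc h; lra.
Qed.

Lemma attains_pr (A : Type) (E : A -> bool) (m : rand R A) v :
  attains (fun a u => u <= (E a)%:R) m v -> v <= pr E m.
Proof.
elim: m v => [a|b k IH] v /=; first by case=> x; apply: le_trans.
case=> hb [v1 [v2 [/IH h1 /IH h2 h]]]; apply: le_trans h _.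
by apply: lerD; apply: ler_wpM2l => //; lra.
Qed.

Lemma pr_predC (A : Type) (E : A -> bool) (m : rand R A) :
  pr (fun a => ~~ E a) m = 1 - pr E m.
Proof.
elim: m => [a|b k IH] /=; first by case: (E a); rewrite ?subrr ?subr0.
by rewrite !IH; ring.
Qed.

Lemma attains_mine (K : bool -> R -> Prop) p q v0 v1 v :
  0 <= p <= 1 -> K false v0 -> K true v1 ->
  v <= (1 - p) ^+ q * v0 + (1 - (1 - p) ^+ q) * v1 ->
  attains K (mine p q) v.
Proof.
move=> hp h0; elim: q K v0 v1 h0 v => [|q IH] K v0 v1 h0 v h1 h.
  by exists v0 => //; move: h; rewrite expr0; lra.
rewrite [mine _ _]/=.
apply: (attains_flip (v1 := v1)
  (v2 := (1 - p) ^+ q * v0 + (1 - (1 - p) ^+ q) * v1)) => //.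
- by apply: attains_bind; apply: (IH _ v1 v1) => //; [exact: attains_ret..|lra].
- by apply: attains_bind; apply: (IH _ v0 v1) => //; exact: attains_ret.
- by apply: le_trans h _; rewrite exprS; lra.
Qed.

(** Linearity is applied twice: to the first tree with the nonnegative factor [v2], and to the
    second with the indicator of the first event, which is constant there. *)
Lemma attains_independent (A B : Type) (E1 : A -> bool) (E2 : B -> bool)
    (E : A * B -> bool) (m1 : rand R A) (m2 : rand R B) v1 v2 :
  (forall a b, E1 a -> E2 b -> E (a, b)) -> 0 <= v2 ->
  attains (fun a u => u <= (E1 a)%:R) m1 v1 ->
  attains (fun a u => u <= (E2 a)%:R) m2 v2 ->
  v1 * v2 <= pr E (independent m1 m2).
Proof.
move=> hE hv2 h1 h2; apply: attains_pr; apply: attains_bind.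
rewrite mulrC -[_ * _]addr0.
apply: attains_mono (attains_affine 0 hv2 h1) => a u [x -> hx].
apply: attains_bind.
apply: (attains_le (v := (E1 a)%:R * v2 + 0)).
  by rewrite !addr0 mulrC ler_wpM2r.
apply: attains_mono (attains_affine 0 (ler0n R (E1 a)) h2) => b u2 [y -> hy].
apply: attains_ret; rewrite addr0.
apply: (le_trans (y := (E1 a)%:R * (E2 b)%:R)); first exact: ler_wpM2l.
rewrite -natrM mulnb ler_nat.
by case: (E1 a) (hE a b) => //; case: (E2 b) => // ->.
Qed.

End LowerBounds.

(** * The adversary and its reactions *)

Definition selfish_clock (n : nat) : {poly nat} :=
  \poly_(i < 2) ((size (delivery_prog n) + 10) * 4)%N.

Lemma selfish_clockE n L : (selfish_clock n).[L] = selfish_time n L.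
Proof.
rewrite horner_poly big_ord_recl big_ord1 /selfish_time /= expr0 expr1.
by rewrite -[GRing.mul]/muln -[GRing.add]/addn -[1]/1%N; lia.
Qed.

(** All queries are asked, so the attack costs as much as following the protocol. *)
Definition selfish_adversary (n q : nat) : adversary n q :=
  {| adv_machine := selfish_machine n;
     adv_clock := selfish_clock n;
     adv_idle := [ffun=> ord0] |}.

Lemma stores_blank n :
  stores (blank (selfish_machine n)) (Memory [::] 0%N false).
Proof.
split=> //; first by exists [::].
by split=> // -[|[]].
Qed.

Lemma selfish_timely (R : realType) n c s L ws :
  stores c s -> fits L s ->
  timely R (selfish_machine n) (fun L => (selfish_clock n).[L]) c L ws.
Proof.
elim: ws c s L => //= w ws IH c s L hc hL.
have hm : (selfish_time n (L + size w) <= (selfish_clock n).[(L + size w)%N])%N.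
  by rewrite selfish_clockE.
apply: surely_mono (selfish_run R hc hL hm) => o [c' -> [hc' _]].
by apply: (IH _ _ _ hc'); apply: fits_step.
Qed.

Lemma selfish_ppt (R : realType) n q : ppt_adversary R (selfish_adversary n q).
Proof. by move=> k ws; exact: (selfish_timely _ _ (stores_blank n)). Qed.

Definition holds n (m : tapes (selfish_machine n) * nat) (s : memory) : Prop :=
  stores m.1 s /\ fits m.2 s.

(** The coins do not influence the reply, so a run of the machine may be replaced by one step of its
    specification without loss in expectation. *)
Lemma attains_selfish (R : realType) n m s w
    (K : seq bool * (tapes (selfish_machine n) * nat) -> R -> Prop) v :
  holds m s ->
  (forall m', holds m' (selfish_step n s w).1 ->
              K ((selfish_step n s w).2, m') v) ->
  attains K (respond R (selfish_machine n) (fun L => (selfish_clock n).[L]) m w)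
    v.
Proof.
case=> hc hL hK.
apply: (attains_surely (E := fun r => r.1 = (selfish_step n s w).2 /\
    holds r.2 (selfish_step n s w).1)); first exact: calibrated_respond.
- apply: surely_bind; rewrite /activate.
  have hm : (selfish_time n (m.2 + size w) <=
             (selfish_clock n).[(m.2 + size w)%N])%N by rewrite selfish_clockE.
  apply: surely_mono (selfish_run R hc hL hm) => o [c' -> [hc' ho]] /=.
  by split=> //; split=> //; apply: fits_step.
- by case=> o m' [/= -> hm']; apply: hK.
Qed.

Definition idle_machine : machine :=
  {| tm_work := 0; tm_state := unit; tm_start := tt;
     tm_delta := fun _ _ _ => None |}.

Lemma idle_timely (R : realType) c L ws :
  timely R idle_machine (fun=> 1%N) c L ws.
Proof. by elim: ws c L => //= w ws IH c L; split; apply: IH. Qed.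

(** One environment suffices for a refutation. This one gives no inputs and lasts [k + 1] rounds, a
    nonconstant polynomial that never vanishes. *)
Definition idle_environment : environment :=
  {| env_machine := idle_machine; env_clock := 1; env_input := fun=> 0%N;
     env_rounds := S |}.

Lemma idle_environment_admissible (R : realType) :
  admissible R idle_environment.
Proof.
split=> //.
- by exists 0 => k; rewrite horner0.
- exists ('X + 1); first by rewrite size_XaddC.
  by move=> k; rewrite hornerD hornerX hornerC -natr1.
- by move=> k ws; rewrite [env_clock _]/= hornerC; apply: idle_timely.
Qed.

(** * Decoding of messages and adoption of chains *)

Lemma index_nseq_true i (s : seq bool) :
  index false (nseq i true ++ false :: s) = i.
Proof. by elim: i => //= i ->. Qed.

Lemma index_enc_nat i s : index false (enc_nat i ++ s) = i.
Proof. by rewrite /enc_nat -catA index_nseq_true. Qed.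

Lemma dec_query_enc i s : dec_query (enc_nat i ++ s) = (i, s).
Proof.
rewrite /dec_query /enc_nat -catA index_nseq_true.
by rewrite drop_cat size_nseq ltnNge leqnSn subSnn /= drop0.
Qed.

Lemma dec_nats_enc i s : dec_nats 0%N (enc_nat i ++ s) = i :: dec_nats 0%N s.
Proof.
suff h k : dec_nats k (enc_nat i ++ s) = (k + i)%N :: dec_nats 0%N s.
  exact: h.
rewrite /enc_nat -catA; elim: i k => [|i IH] k /=; first by rewrite addn0.
by rewrite IH addSnnS.
Qed.

Lemma dec_deliveries_enc (T : Type) (l : seq T) (f g : T -> nat) :
  dec_deliveries (flatten [seq enc_nat (f x) ++ enc_nat (g x) | x <- l]) =
  [seq (f x, g x) | x <- l].
Proof.
rewrite /dec_deliveries; elim: l => //= x l IH.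
by rewrite -catA !dec_nats_enc /= IH.
Qed.

Lemma enc_nat_notin i s : false \in enc_nat i ++ s.
Proof. by rewrite mem_cat mem_cat mem_head orbT. Qed.

Lemma count_enum (T : finType) (a : pred T) : count a (enum T) = #|a|.
Proof. by rewrite cardE [in RHS]/enum_mem -enumT size_filter. Qed.

Lemma chain_at_rcons n (P : pool n) C i :
  (i < size P)%N -> chain_at (rcons P C) i = chain_at P i.
Proof. by move=> h; rewrite nth_rcons h. Qed.

Lemma chain_at_last n (P : pool n) C : chain_at (rcons P C) (size P) = C.
Proof. by rewrite nth_rcons ltnn eqxx. Qed.

Lemma adopt_same n (P : pool n) c s :
  (forall i, i \in s -> size (chain_at P i) <= size (chain_at P c))%N ->
  adopt P c s = c.
Proof.
rewrite /adopt; elim: s => //= i s IH h.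
rewrite ltnNge h ?mem_head //=; apply: IH => j hj.
by apply: h; rewrite inE hj orbT.
Qed.

Lemma adopt_first n (P : pool n) c i s :
  (size (chain_at P c) < size (chain_at P i))%N ->
  (forall j, j \in s -> size (chain_at P j) <= size (chain_at P i))%N ->
  adopt P c (i :: s) = i.
Proof. by move=> h hs; rewrite /adopt /= h; apply: adopt_same. Qed.

Section Reactions.
Variables (n : nat) (us : seq nat) (i : nat) (al : bool).
Let s := Memory us i al.

Lemma step_start k : selfish_step n s (nseq k true) = (s, [::]).
Proof. by rewrite /selfish_step /= mem_nseq andbF. Qed.

Lemma step_seen k l (b : block n) :
  selfish_step n s (enc_signal (Seen k l b)) =
  (if al then s else if us is [::] then Memory [:: k] k true
                     else Memory us i true, [::]).
Proof.
rewrite /selfish_step /enc_signal enc_nat_notin dec_query_enc /= index_enc_nat.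
by case: al => //; case: us.
Qed.

Lemma step_input (j : 'I_n) x :
  selfish_step n s (enc_signal (Input j x)) = (s, [::]).
Proof. by []. Qed.

Lemma step_query (j : 'I_n) :
  selfish_step n s (enc_signal (Query j)) = (s, enc_nat i).
Proof. by []. Qed.

Lemma step_failure (j : 'I_n) :
  selfish_step n s (enc_signal (Result j None)) = (s, [::]).
Proof. by []. Qed.

Lemma step_success (j : 'I_n) k :
  selfish_step n s (enc_signal (Result j (Some k))) =
  (Memory (rcons us k) k al, [::]).
Proof.
rewrite /selfish_step /enc_signal enc_nat_notin dec_query_enc /=.
rewrite enc_nat_notin /= index_enc_nat drop_size_cat; last first.
  by rewrite size_cat size_nseq addn1.
by rewrite -[enc_nat k]cats0 index_enc_nat.
Qed.

Lemma step_deliver :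
  selfish_step n s (enc_signal (Deliver : signal n)) =
  if (al, us) is (true, u :: us') then
    (Memory us' i false, flatten [seq enc_nat j ++ enc_nat u | j <- iota 0%N n])
  else (s, [::]).
Proof. by []. Qed.
End Reactions.

(** * The execution with the selfish miner *)

Section Links.
Variable n : nat.
Implicit Types (P : pool n) (C xs : chain n) (us : seq nat).

(** The indices [us] designate successive one-block extensions of [C] by the blocks [xs], oldest
    first; the tip then carries [catrev xs C]. *)
Fixpoint links P C us xs : Prop :=
  match us, xs with
  | [::], [::] => True
  | u :: us', x :: xs' =>
    [/\ (u < size P)%N, chain_at P u = x :: C & links P (x :: C) us' xs']
  | _, _ => False
  end.

Lemma links_pool P B C us xs : links P C us xs -> links (rcons P B) C us xs.
Proof.
elim: us xs C => [|u us IH] [|x xs] C //= [hu hC h].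
by split; [rewrite size_rcons ltnW|rewrite chain_at_rcons|exact: IH].
Qed.

Lemma links_last P C us xs c : links P C us xs ->
  (c < size P)%N -> chain_at P c = C ->
  (last c us < size P)%N /\ chain_at P (last c us) = catrev xs C.
Proof.
elim: us xs C c => [|u us IH] [|x xs] C c //= [hu hC h] _ _.
exact: IH h hu hC.
Qed.

Lemma links_rcons P C us xs u x : links P C us xs ->
  (u < size P)%N -> chain_at P u = x :: catrev xs C ->
  links P C (rcons us u) (rcons xs x).
Proof.
elim: us xs C => [|u' us IH] [|x' xs] C //= [hu hC h] h1 h2.
by split=> //; apply: IH.
Qed.
End Links.

Section Attack.
Variables (R : realType) (n q : nat) (p a D : R) (T : {set 'I_n}).
Hypotheses (p01 : 0 <= p <= 1) (D_gt0 : 0 < D).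
Variables (ZS : Type) (Z : ZS -> seq bool -> rand R (seq bool * ZS)).
Hypothesis Z_calibrated : forall z w, calibrated (Z z w).

Notation A := (adv_strategy R (selfish_adversary n q)).
Notation W := (world n ZS (mind A)).

Definition owned (b : block n) : bool := producer b \in T.

(* [C] is the chain of all honest participants, [xs] lists the queued blocks
   from the oldest on, and [fl] tells whether a block is going to be released;
   this block may be honest. *)
Definition ahead (s : W) (C : chain n) (xs : chain n) (fl : bool) : Prop :=
  let: World P loc snt y z m := s in
  exists c us,
  [/\ [/\ (c < size P)%N, chain_at P c = C & forall j, j \notin T -> loc j = c],
      links P C us xs, holds m (Memory us (last c us) fl),
      (forall i, i \in snt ->
         (i < size P)%N /\ (size (chain_at P i) <= (size C).+1)%N) /\
      (~~ fl -> snt = [::])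
    & all owned (if fl then behead xs else xs)].

(* The expectation of the potential at the end of the round, when [rem] queries
   of [T] are left and the honest participants have asked theirs. *)
Definition worth (C xs : chain n) (fl : bool) (rem : nat) : R :=
  (count owned C)%:R - a * (size C)%:R
  + (if fl then (has owned (take 1 xs))%:R - a else 0)
  + D * (1 - (1 - D^-1) ^+ (size xs - fl) * (1 - p / D) ^+ rem).

Definition boundary (k : nat) (s : W) (v : R) : Prop :=
  exists C xs, [/\ ahead s C xs false, (size C <= k)%N
                 & v <= worth C xs false 0].

Definition querying (k : nat) (l : seq 'I_n) (s : W) (v : R) : Prop :=
  {subset l <= T} /\ exists C xs fl,
  [/\ ahead s C xs fl, (size C <= k)%N & v <= worth C xs fl (size l)].

(** A success multiplies the power of [1 - D^-1] by one more such factor, so on average a query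
    multiplies it by [1 - p / D]. Hence the closed form of [worth], which is preserved exactly. *)
Lemma attains_query k j l s v : querying k (j :: l) s v ->
  attains (querying k l) (adversarial_query p A s j) v.
Proof.
case=> hl [C [xs [fl [hs hk hv]]]].
have hj : j \in T by apply: hl; rewrite mem_head.
have {}hl : {subset l <= T} by move=> i hi; apply: hl; rewrite inE hi orbT.
case: s hs => P loc snt y z m [c [us [[hc hC hloc] hus hm hsnt hown]]].
(* With the flag set the queue is not empty, so a new block leaves its front alone and the truncated
   [size xs - fl] is exact. *)
have hxs : fl -> xs <> [::].
  case: (hm) => -[_ _ _ h] _ hfl hx; rewrite hx in hus.
  by case: (us) hus (h hfl).
rewrite /adversarial_query; apply: attains_bind.
apply: (attains_selfish hm) => m1; rewrite step_query => hm1.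
lazy beta iota zeta; rewrite -[enc_nat _]cats0 dec_query_enc.
have [ht hCt] := links_last hus hc hC.
apply: (attains_flip (v1 := worth C (rcons xs (Block j [::])) fl (size l))
                     (v2 := worth C xs fl (size l))) => //.
- apply: attains_bind; apply: (attains_selfish hm1) => m2.
  rewrite step_success => hm2; apply: attains_ret; split=> //.
  exists C, (rcons xs (Block j [::])), fl; split=> //.
  exists c, (rcons us (size P)); split=> //.
  + by rewrite size_rcons ltnW // chain_at_rcons.
  + apply: links_rcons; first exact: links_pool.
      by rewrite size_rcons.
    by rewrite chain_at_last hCt.
  + by rewrite last_rcons.
  + split; last by case: hsnt.
    move=> i hi; case: hsnt => /(_ i hi) [h1 h2] _.
    by rewrite size_rcons chain_at_rcons // ltnW.
  + case: (fl) hxs hown => hx; last by rewrite all_rcons /owned hj.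
    by case: (xs) (hx isT) => // x xs' _ /=; rewrite all_rcons /owned hj.
- apply: attains_bind; apply: (attains_selfish hm1) => m2.
  rewrite step_failure => hm2; apply: attains_ret; split=> //.
  by exists C, xs, fl; split=> //; exists c, us; split.
- apply: le_trans hv _; rewrite /worth /= size_rcons.
  have -> : ((size xs).+1 - fl = (size xs - fl).+1)%N.
    case: (fl) hxs => [/(_ isT)|_]; last by rewrite !subn0.
    by case: (xs) => // x xs' _; rewrite !subn1.
  have -> : (if fl then (has owned (take 1 (rcons xs (Block j [::]))))%:R - a
             else 0) = (if fl then (has owned (take 1 xs))%:R - a else 0).
    case: (fl) hxs => [/(_ isT)|//].
    by case: (xs) => //= x xs' _; rewrite !take0.
  rewrite !exprS; set X := _ ^+ _; set Y := _ ^+ _; set N := _ - _.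
  set F := if _ then _ else _.
  by rewrite le_eqVlt; apply/orP; left; apply/eqP; field; rewrite gt_eqF.
Qed.

Lemma deliveries_to_everyone (u : nat) (j : 'I_n) :
  [seq d.2 | d <- dec_deliveries
     (flatten [seq enc_nat i ++ enc_nat u | i <- iota 0%N n]) & d.1 == j :> nat]
  = [:: u].
Proof.
rewrite (dec_deliveries_enc _ id (fun=> u)) filter_map -map_comp.
rewrite (eq_filter (a2 := pred1 (j : nat))) // filter_pred1_uniq ?iota_uniq //.
by rewrite mem_iota add0n ltn_ord.
Qed.

(** A released chain is one block longer than [C], no honest chain of the round is longer, and it is
    received first: all honest participants adopt it. Without an honest block nothing is sent and
    nothing changes. *)
Lemma attains_end_of_round k s v : querying k [::] s v ->
  attains (boundary k.+1) (end_of_round A T s) v.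
Proof.
case=> _ [C [xs [fl [hs hk hv]]]].
case: s hs => P loc snt y z m [c [us [[hc hC hloc] hus hm hsnt hown]]].
rewrite /end_of_round; apply: attains_bind.
apply: (attains_selfish hm) => m1; rewrite step_deliver.
case: fl hv hm hsnt hown => hv hm [hsnt hsnt0] hown; last first.
  move=> hm1; apply: attains_ret; exists C, xs; split=> //; last exact: leqW.
  exists c, us; split=> //; split=> // j hj.
  by rewrite (negbTE hj) hsnt0 //= hloc.
case: us hus hm => [|u us].
  by case: xs {hv hown} => // _ [[_ _ _ /(_ isT)]].
case: xs hown hv => // x xs hown hv [hu hCu hus] hm hm1.
apply: attains_ret; exists (x :: C), xs; split=> //; last first.
  apply: le_trans hv _; rewrite /worth /= take0 orbF subn1 subn0 -natr1 natrD.
  lra.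
exists u, us; split=> //; split=> // j hj; rewrite (negbTE hj).
rewrite deliveries_to_everyone hloc //.
by apply: adopt_first => [|i /hsnt [_ hi]]; rewrite ?hC hCu.
Qed.

Variable m : nat.

(* [worth] after the first honest block of the round. *)
Definition caught (C xs : chain n) : R :=
  if xs is [::] then
    (count owned C)%:R - a * (size C)%:R - a + D * (1 - (1 - p / D) ^+ m)
  else worth C xs true m.

(** [g] is the probability that no remaining honest query succeeds. *)
Definition activating (k : nat) (l : seq 'I_n) (s : W) (v : R) : Prop :=
  exists C xs fl,
  [/\ ahead s C xs fl, (size C <= k)%N
    & let g := (1 - p) ^+ (q * count (fun j => j \notin T) l) in
      v <= if fl then worth C xs true m
           else g * worth C xs false m + (1 - g) * caught C xs].

(** Only the first honest block of a round matters: once the flag is set, later ones leave the queue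
    and its release unchanged. *)
Lemma attains_activate k j l s v : activating k (j :: l) s v ->
  attains (activating k l) (activate_participant q p Z A T s j) v.
Proof.
case=> [C [xs [fl [hs hk hv]]]].
case: s hs => P loc snt y z mm [c [us [[hc hC hloc] hus hm [hsnt hsnt0] hown]]].
rewrite /activate_participant; apply: attains_bind.
apply: attains_calibrated => // -[x z'].
rewrite /= in hv.
case: ifPn => hj; rewrite ?hj /= in hv.
  apply: attains_bind; apply: (attains_selfish hm) => m1 hm1.
  rewrite step_input in hm1 *.
  by apply: attains_ret; exists C, xs, fl; split=> //; exists c, us.
apply: attains_bind.
pose g := (1 - p) ^+ (q * count (fun j => j \notin T) l).
apply: (attains_mine
  (v0 := if fl then worth C xs true m
         else g * worth C xs false m + (1 - g) * caught C xs)
  (v1 := if fl then worth C xs true m else caught C xs)) => //.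
- by apply: attains_ret; exists C, xs, fl; split=> //; exists c, us.
- apply: attains_bind; apply: (attains_selfish hm) => m1.
  rewrite step_seen /= => hm1; apply: attains_ret.
  have hsnt' : forall i, i \in rcons snt (size P) ->
      (i < size (rcons P (Block j x :: C)))%N /\
      (size (chain_at (rcons P (Block j x :: C)) i) <= (size C).+1)%N.
    move=> i; rewrite mem_rcons inE => /orP [/eqP ->|/hsnt [h1 h2]].
      by rewrite chain_at_last size_rcons.
    by rewrite chain_at_rcons // size_rcons ltnW.
  have hc' : [/\ (c < size (rcons P (Block j x :: C)))%N,
      chain_at (rcons P (Block j x :: C)) c = C
      & forall j, j \notin T -> loc j = c].
    by rewrite chain_at_rcons // size_rcons ltnW.
  rewrite hloc // hC in hm1 *.
  have hus' := links_pool (Block j x :: C) hus.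
  case: fl hv hm hsnt0 hown hm1 => hv hm hsnt0 hown hm1.
    by exists C, xs, true; split=> //; exists c, us; split.
  case: us hus hm hm1 hus' => [|u us] hus hm hm1 hus'.
    case: xs {hv} hus hown hus' => // _ hown _.
    exists C, [:: Block j x], true; split=> //.
      exists c, [:: size P]; split=> //.
      by rewrite /= size_rcons chain_at_last.
    by rewrite /worth /= /owned /= (negbTE hj) subnn expr0 mul1r mulr0n; lra.
  case: xs {hv} hus hown hus' => // x0 xs hus hown hus'.
  exists C, (x0 :: xs), true; split=> //.
  exists c, (u :: us); split=> //.
  by case/andP: hown.
- apply: le_trans hv _; rewrite mulnS exprD -/g.
  by case: (fl); lra.
Qed.

Variable c : R.
(** In contrast to [activating], [g] is now the probability that an honest block appears in the
    round; [b] is the mean factor that the queries of [T] contribute to the power of [1 - D^-1]. *)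
Let g := 1 - (1 - p) ^+ (q * count (fun j => j \notin T) (enum 'I_n)).
Let b := (1 - p / D) ^+ m.
Hypotheses (D_ge1 : 1 <= D) (b01 : 0 <= b <= 1) (g_le1 : 0 <= g <= 1).
Hypotheses (c_le_full : c <= (1 - a) * g).
Hypotheses (c_le_empty : c <= (D - 1) * (1 - b) - a * g).
Hypothesis mE : m = (q * #|T|)%N.

(** For a nonempty queue, let [t] be the power of [1 - D^-1] belonging to its tail. The drift equals
    [1 - t] times [(1 - a) * g], the gain from a deep queue, plus [t] times
    [(D - 1) * (1 - b) - a * g], the gain from a shallow one, plus [t * g * (1 - b) >= 0]; both
    gains are at least [c]. For an empty queue the drift is [D * (1 - b) - a * g]. *)
Lemma worth_drift C xs : all owned xs ->
  worth C xs false 0 + c <= (1 - g) * worth C xs false m + g * caught C xs.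
Proof.
have DE : D * D^-1 = 1 by rewrite mulfV // gt_eqF.
case: xs => [_|x xs /= /andP [hx _]]; rewrite /worth /= ?hx -/b.
  rewrite !subn0 !expr0 -/b; move: (_ - _ * _) => N.
  by move: b g b01 c_le_empty => b' g' ? ?; lra.
rewrite /= ?take0 ?subn1 ?subn0 /= exprS expr0 -?/b.
have : 0 <= (1 - D^-1) ^+ size xs <= 1.
  have hD : 0 <= D^-1 by rewrite invr_ge0 ltW.
  have hD1 : D^-1 <= 1 by rewrite invf_le1.
  by rewrite exprn_ge0 ?exprn_ile1; lra.
move: (_ ^+ size xs) => t ht.
have -> : D * (1 - (1 - D^-1) * t * 1) = D - (D * 1 - D * D^-1) * t by ring.
have -> : D * (1 - (1 - D^-1) * t * b) = D - (D * 1 - D * D^-1) * t * b by ring.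
rewrite DE.
have h1 : 0 <= (1 - t) * ((1 - a) * g - c).
  by apply: mulr_ge0; [lra|rewrite subr_ge0].
have h2 : 0 <= t * ((D - 1) * (1 - b) - a * g - c).
  by apply: mulr_ge0; [case/andP: ht|rewrite subr_ge0].
have h3 : 0 <= t * (g * (1 - b)).
  case/andP: ht => ht _; case/andP: g_le1 => hg _; case/andP: b01 => _ hb.
  by rewrite !mulr_ge0 // subr_ge0.
rewrite [true%:R]mulr1n; move: h1 h2 h3.
move: (size C)%:R (count _ _)%:R b g => L N b' g'.
by move=> *; lra.
Qed.

Lemma attains_round k s v : boundary k s v ->
  attains (boundary k.+1)
    (round p Z A T (adv_idle (selfish_adversary n q)) s) (v + c).
Proof.
case=> C [xs [hs hk hv]]; rewrite /round; apply: attains_bind.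
have hact : activating k (enum 'I_n) s (v + c).
  exists C, xs, false; split=> //=.
  have hx : all owned xs by case: (s) hs => ? ? ? ? ? ? [? [? []]].
  have := worth_drift C hx; rewrite /g; lra.
apply: attains_mono (attains_foldM (@attains_activate k) hact) => s1 v1.
case=> C1 [xs1 [fl1 [hs1 hk1 hv1]]]; rewrite /= muln0 expr0 in hv1.
apply: attains_bind; set l := flatten _.
have hl : size l = m.
  rewrite mE /l cardE mulnC; elim: (enum T) => //= i e IH.
  by rewrite size_cat size_nseq ffunE subn0 IH mulSn.
have hq : querying k l s1 v1.
  split.
    move=> i /flattenP [_ /mapP [j hj ->]].
    by rewrite mem_nseq => /andP [_ /eqP ->]; rewrite mem_enum in hj.
  exists C1, xs1, fl1; split=> //; rewrite hl.
  by apply: le_trans hv1 _; case: (fl1); lra.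
apply: attains_mono (attains_foldM (@attains_query k) hq) => s2 v2.
exact: attains_end_of_round.
Qed.

Lemma attains_rounds (I : Type) (l : seq I) k s v : boundary k s v ->
  attains (boundary (k + size l))
    (foldM (fun s _ => round p Z A T (adv_idle (selfish_adversary n q)) s) s l)
    (v + c * (size l)%:R).
Proof.
elim: l k s v => [|i l IH] k s v h /=.
  by rewrite mulr0 addr0 addn0; apply: attains_ret.
apply: attains_bind.
have -> : v + c * (size l).+1%:R = 1 * (v + c) + c * (size l)%:R.
  by rewrite -natr1; ring.
apply: attains_mono (attains_affine _ ler01 (attains_round h)) => s' u.
case=> x -> hx.
by rewrite mul1r -addSnnS; apply: IH.
Qed.

End Attack.

(** The potential starts at zero and exceeds [N - a L] by at most [D], whence the summand [D]. The
    public chain grows by at most one block in a round. *)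
Lemma attains_attack (R : realType) (n q : nat) (p a D c : R) (T : {set 'I_n})
    (E : environment) k :
  let g := 1 - (1 - p) ^+ (q * #|~: T|) in
  let b := (1 - p / D) ^+ (q * #|T|) in
  0 <= p <= 1 -> 1 <= D ->
  c <= (1 - a) * g -> c <= (D - 1) * (1 - b) - a * g ->
  attains (fun o u => exists C : chain n,
      [/\ forall j, j \notin T -> o j = C, (size C <= env_rounds E k)%N
        & u <= (count (owned T) C)%:R - a * (size C)%:R + D])
    (execution p E (adv_strategy R (selfish_adversary n q)) T
       (adv_idle (selfish_adversary n q)) k)
    (c * (env_rounds E k)%:R).
Proof.
move=> g b hp hD hc1 hc2; have D_gt0 : 0 < D by apply: lt_le_trans hD.
have hb : 0 <= b <= 1.
  have hpD : 0 <= p / D <= 1 by rewrite divr_ge0 ?ler_pdivrMr ?mul1r //; lra.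
  by rewrite exprn_ge0 ?exprn_ile1; lra.
have hg : 0 <= g <= 1.
  have : 0 <= (1 - p) ^+ (q * #|~: T|) <= 1.
    by rewrite exprn_ge0 ?exprn_ile1; lra.
  by rewrite /g; lra.
have hT : count (fun j => j \notin T) (enum 'I_n) = #|~: T|.
  by rewrite count_enum; apply: eq_card => j; rewrite !inE.
rewrite /execution; apply: attains_bind.
apply: attains_calibrated => [|z]; first exact: calibrated_boot.
apply: attains_bind; apply: attains_bind.
apply: (attains_selfish (s := Memory [::] 0%N false)).
  by split; [exact: stores_blank|].
move=> m0; rewrite step_start => hm; apply: attains_ret.
apply: attains_bind; set l := iota _ _.
set s0 := World _ _ _ _ _ _.
have h0 : boundary p a D T 0 s0 (0 : R).
  exists [::], [::]; split=> //; first by exists 0%N, [::].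
  by rewrite /worth /= !expr0; lra.
rewrite /g -hT in hg hc1 hc2.
have h := attains_rounds hp D_gt0 _ hD hb hg hc1 hc2 (erefl _) l h0.
move: h; rewrite /l size_iota add0r add0n => h.
apply: attains_mono (h _ _) => [s u|z' w]; last exact: calibrated_respond.
case=> C [xs [hs hC hu]]; apply: attains_ret; exists C; split=> //.
  case: s hs => P loc snt y zz mm [i [us [[_ <- hloc] _ _ _ _]]] j hj.
  by rewrite /= hloc.
apply: le_trans hu _; rewrite /worth addr0 lerD2l expr0 mulr1.
rewrite ler_piMr ?(ltW D_gt0) // gerBl exprn_ge0 // subr_ge0 invf_le1 //.
Qed.

(** * The execution with the honest coalition *)

Section Compliance.
Variables (R : realType) (n q : nat) (p b : R) (T : {set 'I_n}).
Hypotheses (p01 : 0 <= p <= 1).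
Variables (ZS : Type) (Z : ZS -> seq bool -> rand R (seq bool * ZS)).
Hypothesis Z_calibrated : forall z w, calibrated (Z z w).

Notation A := (follow R T).
Notation W := (world n ZS (mind A)).

Definition next_to (P : pool n) (C : chain n) (mine : bool) (i : nat) : Prop :=
  (i < size P)%N /\ exists2 x, chain_at P i = x :: C & owned T x = mine.

(** Everyone, including the members of [T], considers the same chains in the same order, those of
    [T] first. So all keep one common chain, designated by [c]. *)
Definition agreed (s : W) (C : chain n) (found seen : bool) : Prop :=
  let: World P loc snt y z (HonestMind hd inp fnd sn) := s in
  exists c,
  [/\ [/\ (c < size P)%N, chain_at P c = C, forall j, j \notin T -> loc j = c
        & forall j, hd j = c],
      sn = snt,
      forall i, i \in unzip2 fnd -> next_to P C true i,
      forall i, i \in snt -> next_to P C false i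
    & found = (fnd != [::]) /\ seen = (snt != [::]) ].

(* A lower bound on the expectation of [b L - N] at the end of the round. The
   flags tell whether [T] and the others have found a block, [queries] counts
   the queries that are left, [rem] those of [T]. *)
Definition score (C : chain n) (found seen : bool) (queries rem : nat) : R :=
  b * (size C)%:R - (count (owned T) C)%:R
  + b * (1 - (~~ found && ~~ seen)%:R * (1 - p) ^+ queries)
  - (if found then 1 else p * rem%:R).

Definition settled (k : nat) (s : W) (v : R) : Prop :=
  exists C, [/\ agreed s C false false, (size C <= k)%N
              & v <= b * (size C)%:R - (count (owned T) C)%:R].

Definition asking (k : nat) (l : seq 'I_n) (s : W) (v : R) : Prop :=
  {subset l <= T} /\ exists C f g,
  [/\ agreed s C f g, (size C <= k)%N & v <= score C f g (size l) (size l)].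

Variable m : nat.

Definition acting (k : nat) (l : seq 'I_n) (s : W) (v : R) : Prop :=
  exists C f g, [/\ agreed s C f g, (size C <= k)%N
   & v <= score C f g (q * count (fun j => j \notin T) l + m) m].

Lemma next_to_rcons P C B x i :
  next_to P C B i -> next_to (rcons P x) C B i.
Proof.
case=> hi [y hy hB]; split; first by rewrite size_rcons ltnW.
by exists y => //; rewrite chain_at_rcons.
Qed.

Lemma next_to_last P C x : next_to (rcons P (x :: C)) C (owned T x) (size P).
Proof.
by split; [rewrite size_rcons|exists x => //; rewrite chain_at_last].
Qed.

Lemma attains_ask k j l s v : asking k (j :: l) s v ->
  attains (asking k l) (adversarial_query p A s j) v.
Proof.
case=> hl [C [f [g [hs hk hv]]]].
have hj : j \in T by apply: hl; rewrite mem_head.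
have {}hl : {subset l <= T} by move=> i hi; apply: hl; rewrite inE hi orbT.
case: s hs => P loc snt y z [hd inp fnd sn].
case=> c [[hc hC hloc hhd] -> hf hs [ef es]].
rewrite /adversarial_query [react _ _ _]/= hhd /bind dec_query_enc hC.
apply: (attains_flip (v1 := score C true g (size l) (size l))
                     (v2 := score C f g (size l) (size l))) => //.
- rewrite /=; apply: attains_ret; split=> //; exists C, true, g; split=> //.
  have hc' : (c < size (rcons P (Block j (inp j) :: C)))%N.
    by rewrite size_rcons ltnW.
  have hs' i : i \in snt ->
    next_to (rcons P (Block j (inp j) :: C)) C false i.
    by move=> hi; apply: next_to_rcons; apply: hs.
  case: ifPn => hfnd /=; exists c; split=> //; rewrite ?chain_at_rcons //.
  + by move=> i hi; apply: next_to_rcons; apply: hf.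
  + by split=> //; case: (fnd) hfnd.
  + move=> i; rewrite /unzip2 map_rcons mem_rcons inE => /orP [/eqP ->|hi].
      by have := next_to_last P C (Block j (inp j)); rewrite /owned /= hj.
    by apply: next_to_rcons; apply: hf.
  + by split=> //; case: (fnd).
- rewrite /=; apply: attains_ret; split=> //.
  by exists C, f, g; split=> //; exists c.
- apply: le_trans hv _; rewrite /score /= exprS -natr1.
  (* While [T] has found nothing, the union bound [p * rem] loses exactly this term in one query. *)
  have hp2 : 0 <= p * (p * (size l)%:R).
    by case/andP: p01 => p0 _; rewrite !mulr_ge0 ?ler0n.
  by case: (f); case: (g) => /=; rewrite ?mulr1n ?mulr0n; lra.
Qed.

Lemma attains_act k j l s v : acting k (j :: l) s v ->
  attains (acting k l) (activate_participant q p Z A T s j) v.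
Proof.
case=> [C [f [g [hs hk hv]]]].
case: s hs => P loc snt y z [hd inp fnd sn].
case=> c [[hc hC hloc hhd] -> hf hs [ef es]].
rewrite /activate_participant; apply: attains_bind.
apply: attains_calibrated => // -[x z'].
rewrite /= in hv.
case: ifPn => hj; rewrite ?hj /= in hv *.
  by apply: attains_ret; exists C, f, g; split=> //; exists c.
apply: attains_bind.
pose h := (q * count (fun j => j \notin T) l + m)%N.
apply: (attains_mine (v0 := score C f g h m) (v1 := score C f true h m)) => //.
- by apply: attains_ret; exists C, f, g; split=> //; exists c.
- apply: attains_ret; exists C, f, true; split=> //; exists c.
  rewrite hloc // hC; split=> //.
  + by rewrite size_rcons ltnW // chain_at_rcons.
  + by move=> i hi; apply: next_to_rcons; apply: hf.
  + move=> i; rewrite mem_rcons inE => /orP [/eqP ->|hi].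
      by have := next_to_last P C (Block j x); rewrite /owned /= (negbTE hj).
    by apply: next_to_rcons; apply: hs.
  + by split=> //; case: (snt).
- apply: le_trans hv _; rewrite mulnDr muln1 -addnA -/h /score exprD.
  by case: (f); case: (g) => /=; rewrite ?mulr1n ?mulr0n; lra.
Qed.

Lemma deliveries_to_honest (s : seq nat) (j : 'I_n) : j \notin T ->
  [seq d.2 | d <- dec_deliveries
     (flatten [seq enc_nat (i : 'I_n) ++ enc_nat u | u <- s, i <- enum (~: T)])
     & d.1 == j :> nat] = s.
Proof.
move=> hj.
have -> : [seq enc_nat (i : 'I_n) ++ enc_nat u | u <- s, i <- enum (~: T)] =
    [seq enc_nat (nat_of_ord x.2) ++ enc_nat x.1 | x : nat * 'I_n <-
       [seq (u, i) | u <- s, i <- enum (~: T)]].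
  by rewrite map_allpairs.
rewrite (dec_deliveries_enc _ (fun x => nat_of_ord x.2) fst).
elim: s => //= u s IH.
rewrite map_cat filter_cat map_cat IH -map_comp filter_map -map_comp.
rewrite (eq_filter (a2 := pred1 j)) // filter_pred1_uniq ?enum_uniq //.
by rewrite mem_enum inE.
Qed.

(** Every chain found in the round extends the common one by one block, so the first of the inbox,
    if any, is adopted: one of [T] if [T] has found any. *)
Lemma attains_settle k s v : asking k [::] s v ->
  attains (settled k.+1) (end_of_round A T s) v.
Proof.
case=> _ [C [f [g [hs hk hv]]]].
case: s hs => P loc snt y z [hd inp fnd sn].
case=> c [[hc hC hloc hhd] -> hf hs [ef es]].
rewrite /end_of_round [react _ _ _]/= /bind; apply: attains_ret.
set inbox := unzip2 fnd ++ snt.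
have hbox i : i \in inbox ->
    exists2 x, next_to P C (owned T x) i & chain_at P i = x :: C.
  rewrite mem_cat => /orP [/hf|/hs] [hi [x hx ho]]; exists x => //;
    by split=> //; exists x.
have {hbox} [c' hc' [C' [hC' hk' hv']]] : exists2 c', adopt P c inbox = c' &
    exists C', [/\ (c' < size P)%N /\ chain_at P c' = C', (size C' <= k.+1)%N
       & v <= b * (size C')%:R - (count (owned T) C')%:R].
  have hfirst i r : inbox = i :: r -> adopt P c inbox = i.
    move=> e; rewrite e; apply: adopt_first.
      by have [|x _ ->] := hbox i; rewrite ?e ?mem_head // hC /=.
    move=> i' hi'; have [|x _ ->] := hbox i; first by rewrite e mem_head.
    by have [|x' _ ->] := hbox i'; first by rewrite e inE hi' orbT.
  move: hv; rewrite /score /= ef es.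
  case E1: fnd => [|[j i] r] /=.
    case E2: snt => [|i r] /=; rewrite ?mulr1n ?mulr0n => hv.
      exists c; first by rewrite /inbox E1 E2.
      by exists C; split; [|exact: leqW|apply: le_trans hv _; lra].
    exists i; first by apply: (hfirst _ r); rewrite /inbox E1 E2.
    have [|hi [x hx ho]] := hs i; first by rewrite E2 mem_head.
    exists (x :: C); split=> //; apply: le_trans hv _.
    by rewrite /= ho -natr1 add0n; lra.
  rewrite mulr0n => hv.
  exists i; first by apply: (hfirst _ (unzip2 r ++ snt)); rewrite /inbox E1.
  have [|hi [x hx ho]] := hf i; first by rewrite E1 mem_head.
  exists (x :: C); split=> //; apply: le_trans hv _.
  by rewrite /= ho natrD -natr1 mulr1n; lra.
exists C'; split=> //; exists c'; split=> //.
split; [by case: hC'|by case: hC'| |].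
- by move=> j hj; rewrite (negbTE hj) deliveries_to_honest // hloc.
- by move=> j; rewrite hhd.
Qed.

Variable c : R.
Hypothesis mE : m = (q * #|T|)%N.
Hypothesis c_le : c <=
  b * (1 - (1 - p) ^+ (q * count (fun j => j \notin T) (enum 'I_n) + m))
  - p * m%:R.
Notation no_idle := ([ffun=> ord0] : {ffun 'I_n -> 'I_q.+1}).

Lemma attains_honest_round k s v : settled k s v ->
  attains (settled k.+1) (round p Z A T no_idle s) (v + c).
Proof.
case=> C [hs hk hv]; rewrite /round; apply: attains_bind.
have hact : acting k (enum 'I_n) s (v + c).
  exists C, false, false; split=> //; rewrite /score /= mulr1n.
  by move: c_le; move: (_ ^+ _) => Y; lra.
apply: attains_mono (attains_foldM (@attains_act k) hact) => s1 v1.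
case=> C1 [f1 [g1 [hs1 hk1 hv1]]]; rewrite /= muln0 add0n in hv1.
apply: attains_bind; set l := flatten _.
have hq : asking k l s1 v1.
  split.
    move=> i /flattenP [_ /mapP [j hj ->]].
    by rewrite mem_nseq => /andP [_ /eqP ->]; rewrite mem_enum in hj.
  exists C1, f1, g1; split=> //.
  suff -> : size l = m by [].
  rewrite mE /l cardE mulnC; elim: (enum T) => //= i e IH.
  by rewrite size_cat size_nseq ffunE subn0 IH mulSn.
apply: attains_mono (attains_foldM (@attains_ask k) hq) => s2 v2.
exact: attains_settle.
Qed.

Lemma attains_honest_rounds (I : Type) (l : seq I) k s v : settled k s v ->
  attains (settled (k + size l))
    (foldM (fun s _ => round p Z A T no_idle s) s l) (v + c * (size l)%:R).
Proof.
elim: l k s v => [|i l IH] k s v h /=.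
  by rewrite mulr0 addr0 addn0; apply: attains_ret.
apply: attains_bind.
have -> : v + c * (size l).+1%:R = 1 * (v + c) + c * (size l)%:R.
  by rewrite -natr1; ring.
apply: attains_mono (attains_affine _ ler01 (attains_honest_round h)) => s' u.
by case=> x -> hx; rewrite mul1r -addSnnS; apply: IH.
Qed.

End Compliance.

(** A round adds a block unless all [q * n] queries fail, and this block is due to [T] with
    probability at most [p * (q * #|T|)]. *)
Lemma attains_compliance (R : realType) (n q : nat) (p b c : R) (T : {set 'I_n})
    (E : environment) k :
  0 <= p <= 1 ->
  c <= b * (1 - (1 - p) ^+ (q * n)) - p * (q * #|T|)%:R ->
  attains (fun o u => exists C : chain n,
      [/\ forall j, j \notin T -> o j = C, (size C <= env_rounds E k)%N
        & u <= b * (size C)%:R - (count (owned T) C)%:R])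
    (execution p E (follow R T) T ([ffun=> ord0] : {ffun 'I_n -> 'I_q.+1}) k)
    (c * (env_rounds E k)%:R).
Proof.
move=> hp hc.
have hT : (count (fun j => j \notin T) (enum 'I_n) + #|T| = n)%N.
  rewrite count_enum -[RHS]card_ord addnC -(cardC T); congr (_ + _)%N.
rewrite /execution; apply: attains_bind.
apply: attains_calibrated => [|z]; first exact: calibrated_boot.
rewrite [start _ _]/= /=; apply: attains_bind; set l := iota _ _.
set s0 := World _ _ _ _ _ _.
have h0 : settled (T := T) b 0 s0 0.
  exists [::]; split=> //; first by exists 0%N.
  by rewrite mulr0 subr0.
rewrite -{1}hT mulnDr in hc.
have h := attains_honest_rounds hp _ (erefl _) hc l h0.
move: h; rewrite /l size_iota add0r add0n => h.
apply: attains_mono (h _ _) => [s u|z' w]; last exact: calibrated_respond.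
case=> C [hs hC hu]; apply: attains_ret; exists C; split=> //.
case: s hs => P loc snt y zz [hd inp fnd sn] [i [[_ <- hloc _] _ _ _ _]] j hj.
by rewrite /= hloc.
Qed.

(** * Drift and utilities *)

Section Numbers.
Variable R : realType.
Implicit Types (x p : R).

Lemma bernoulli_ge x m : 0 <= x <= 1 -> 1 - x * m%:R <= (1 - x) ^+ m.
Proof.
move=> hx; elim: m => [|m IH]; first by rewrite expr0; lra.
have : (1 - x) ^+ m <= 1 by rewrite exprn_ile1; lra.
rewrite exprS -natr1; move: (_ ^+ _) (m%:R) IH => y M IH hy.
have : 0 <= x * (1 - y) by apply: mulr_ge0; lra.
lra.
Qed.

(** Equivalently, [1 - (1 - x) ^+ m] is at least [x m / (1 + x m)], a lower bound for the
    probability of a success. *)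
Lemma bernoulli_le x m : 0 <= x <= 1 -> (1 - x) ^+ m * (1 + x * m%:R) <= 1.
Proof.
move=> hx; elim: m => [|m IH]; first by rewrite expr0; lra.
have : 0 <= (1 - x) ^+ m by rewrite exprn_ge0; lra.
rewrite exprS -natr1; move: (_ ^+ _) (ler0n R m) IH => y.
move: m%:R => M hM IH hy.
have : 0 <= y * (x * x * (M + 1)) by rewrite !mulr_ge0 //; lra.
lra.
Qed.

End Numbers.

(** * Relative rewards *)

Section Utility.
Variables (R : realType) (n : nat) (w : R) (T : {set 'I_n}).
Hypothesis w_gt0 : 0 < w.

Lemma rewardE (S : {set 'I_n}) j (o : outcome n) :
  reward w S j o = w * (count (owned S) (o j))%:R.
Proof.
rewrite /reward -sum1_count natr_sum mulr_sumr.
by apply: eq_bigr => b _; rewrite mulr1.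
Qed.

(** The reward [w] cancels; for the empty chain, division by zero yields the prescribed value 0. *)
Lemma relative_rewardsE j (o : outcome n) :
  relative_rewards w T j o = (count (owned T) (o j))%:R / (size (o j))%:R.
Proof.
rewrite /relative_rewards !rewardE.
have -> : count (owned [set: 'I_n]) (o j) = size (o j).
  by rewrite (eq_count (a2 := predT)) ?count_predT // => b; rewrite /owned inE.
rewrite mulf_eq0 negb_or gt_eqF //= pnatr_eq0.
case: eqP => [->|/eqP h] /=; first by rewrite invr0 mulr0.
by rewrite -mulf_div divff ?mul1r // gt_eqF.
Qed.

Lemma relative_rewards_ge0 j (o : outcome n) : 0 <= relative_rewards w T j o.
Proof. by rewrite relative_rewardsE divr_ge0. Qed.

Lemma relative_rewards_le1 j (o : outcome n) : relative_rewards w T j o <= 1.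
Proof.
rewrite relative_rewardsE; case: (posnP (size (o j))) => [->|h].
  by rewrite invr0 mulr0.
by rewrite ler_pdivrMr ?ltr0n // mul1r ler_nat count_size.
Qed.

(** The length being at most the number of rounds, this turns the expectation of a linear potential
    into a bound on the probability of a large utility. *)
Lemma relative_rewards_gt (a : R) j (o : outcome n) : 0 <= a ->
  (count (owned T) (o j))%:R - a * (size (o j))%:R <=
  (size (o j))%:R * (a < relative_rewards w T j o)%R%:R.
Proof.
move=> ha; have hc : (count (owned T) (o j))%:R <= (size (o j))%:R :> R.
  by rewrite ler_nat count_size.
have hs := mulr_ge0 ha (ler0n R (size (o j))).
rewrite relative_rewardsE; case: ltP => h; first by rewrite mulr1; lra.
rewrite mulr0 subr_le0.
case: (posnP (size (o j))) h hc => [-> _|hp h _]; first by rewrite mulr0.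
by rewrite ler_pdivrMr ?ltr0n in h.
Qed.

Lemma relative_rewards_le (b : R) j (o : outcome n) : 0 <= b ->
  b * (size (o j))%:R - (count (owned T) (o j))%:R <=
  b * (size (o j))%:R * (relative_rewards w T j o <= b)%R%:R.
Proof.
move=> hb; rewrite relative_rewardsE; case: (leP (_ / _) b) => h.
  by rewrite mulr1 gerBl.
rewrite mulr0 subr_le0.
case: (posnP (size (o j))) h => [->|hp h]; first by rewrite mulr0.
by rewrite ltr_pdivlMr ?ltr0n // in h; apply: ltW.
Qed.

End Utility.

Lemma max_over_ge (R : realType) n (S : {set 'I_n}) (f : 'I_n -> R) j :
  j \in S -> f j <= max_over S f.
Proof.
rewrite /max_over => hj; case: pickP => [i _|/(_ j)]; last by rewrite hj.
exact: le_bigmax_cond.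
Qed.

Lemma min_over_le (R : realType) n (S : {set 'I_n}) (f : 'I_n -> R) j :
  j \in S -> min_over S f <= f j.
Proof.
rewrite /min_over => hj; case: pickP => [i _|/(_ j)]; last by rewrite hj.
exact: bigmin_le_cond.
Qed.

Lemma min_over_ge0 (R : realType) n (S : {set 'I_n}) (f : 'I_n -> R) :
  (forall j, 0 <= f j) -> 0 <= min_over S f.
Proof.
by move=> hf; rewrite /min_over; case: pickP => // i _; apply/bigmin_geP.
Qed.

Lemma exists_set_card n k : (k <= n)%N -> exists T : {set 'I_n}, #|T| = k.
Proof.
move=> h; exists [set i in take k (enum 'I_n)].
rewrite cardsE (card_uniqP _) ?take_uniq ?enum_uniq //.
by rewrite size_take size_enum_ord; case: ltngtP h.
Qed.

(** Here [h] and [m] count the queries of the honest participants and of [T] in a round. From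
    [g <= p h] follows [a * g <= (1 - d) * mu]. With [b] for [(1 - p / D) ^+ m],
    [b <= D / (D + mu)], and since [d * (D - 1) = 2 * (1 + mu)], [(D - 1) * (1 - b)] is at least
    [mu - d * mu / 2]; a gain of [d * mu / 2] remains. *)
Lemma attack_drift (R : realType) (p d : R) (h m : nat) :
  0 < p <= 1 -> 0 < d < 1 -> (0 < m < h)%N ->
  let a := m%:R / h%:R * (1 - d) in
  let mu := p * m%:R in
  let D := 1 + 2 * (1 + mu) / d in
  let g := 1 - (1 - p) ^+ h in
  exists2 c : R, 0 < c & c <= (1 - a) * g /\
                     c <= (D - 1) * (1 - (1 - p / D) ^+ m) - a * g.
Proof.
move=> /andP [p0 p1] /andP [d0 d1] /andP [m0 mh] a mu D g.
have m0R : 0 < m%:R :> R by rewrite ltr0n.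
have h0R : 0 < h%:R :> R by rewrite ltr0n (ltn_trans m0).
have mu0 : 0 < mu by rewrite mulr_gt0.
have p01 : 0 <= p <= 1 by rewrite ltW.
have g0 : 0 < g.
  rewrite /g subr_gt0; have := bernoulli_le h p01.
  have : 0 <= (1 - p) ^+ h by rewrite exprn_ge0 // subr_ge0.
  have : 0 < p * h%:R by rewrite mulr_gt0.
  move: (_ ^+ _) (_ * _) => y z hz hy hyz; rewrite ltNge; apply/negP => h1.
  have : 0 <= (y - 1) * (1 + z) by rewrite mulr_ge0; lra.
  lra.
have gle : g <= p * h%:R by have := bernoulli_ge h p01; rewrite /g; lra.
have a0 : 0 <= a by rewrite !mulr_ge0 ?invr_ge0 ?ler0n // subr_ge0 ltW.
have a1 : a < 1.
  rewrite /a; apply: (le_lt_trans (y := 1 * (1 - d))); last by lra.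
  apply: ler_wpM2r; first by lra.
  by apply: ltW; rewrite ltr_pdivrMr // mul1r ltr_nat.
have ag : a * g <= (1 - d) * mu.
  apply: (le_trans (ler_wpM2l a0 gle)).
  by rewrite /a /mu le_eqVlt; apply/orP; left; apply/eqP; field; rewrite gt_eqF.
have hD : d * (D - 1) = 2 * (1 + mu).
  by rewrite /D; field; rewrite gt_eqF.
have D1 : 1 < D by rewrite /D ltrDl !mulr_gt0 ?invr_gt0 ?addr_gt0.
have D0 : 0 < D by apply: lt_trans D1.
have pD : 0 <= p / D <= 1.
  by apply/andP; split; [apply: divr_ge0; lra|rewrite ler_pdivrMr //; lra].
have hb := bernoulli_le m pD.
set b := (1 - p / D) ^+ m in hb *.
have hb' : b * (D + mu) <= D.
  have -> : b * (D + mu) = D * (b * (1 + p / D * m%:R)).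
    by rewrite /mu; field; rewrite gt_eqF.
  by rewrite -[leRHS]mulr1 ler_wpM2l // ltW.
clearbody b D g a mu.
have key : mu - d * mu / 2 <= (D - 1) * (1 - b).
  rewrite -(ler_pM2r (x := D + mu)); last by rewrite addr_gt0.
  have h1 : (D - 1) * mu <= (D - 1) * (1 - b) * (D + mu).
    by rewrite -mulrA; apply: ler_wpM2l; lra.
  apply: le_trans h1.
  have h2 : 0 <= d * mu * mu by rewrite !mulr_ge0 ?ltW.
  have h3 : 0 <= d * mu by rewrite !mulr_ge0 ?ltW.
  have h4 : mu * (d * (D - 1)) = mu * (2 * (1 + mu)) by rewrite hD.
  lra.
exists (Num.min ((1 - a) * g) (d * mu / 2)).
  by rewrite lt_min mulr_gt0 ?subr_gt0 //= !mulr_gt0 ?invr_gt0.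
split; first by rewrite ge_min lexx.
rewrite ge_min; apply/orP; right; lra.
Qed.

(** * The two executions combined *)

Theorem theorem5 (R : realType) (n q : nat) (p w : R) (t t' : nat)
    (delta' delta'' : R)
    (q_gt0 : (0 < q)%N) (p_gt0 : 0 < p) (p_le1 : p <= 1) (w_gt0 : 0 < w)
    (t_bounds : (1 <= t <= n - 1)%N)
    (t'_gt0 : (0 < t')%N)
    (t'_lt : (t'%:R : R) < Num.min (n%:R / 2) (t%:R + 1))
    (delta'_bounds : 0 < delta' < 1) (delta''_gt0 : 0 < delta'') :
  let s := p * q%:R * n%:R in
  forall eps eps' : R, 0 <= eps -> 0 <= eps' ->
    eps + eps' < t'%:R / (n%:R - t'%:R) * (1 - delta')
                 - t'%:R / n%:R * (1 + delta'') * (1 + s) ->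
    ~ EVP q p t eps eps' (relative_rewards w (n := n)).
Proof.
move=> s eps eps' heps heps' hgap hEVP.
have t't : (t' <= t)%N.
  by rewrite -ltnS -(ltr_nat R) -natr1; move: t'_lt; rewrite lt_min => /andP [].
have t'n2 : (t' * 2 < n)%N.
  move: t'_lt; rewrite lt_min => /andP [h _].
  by rewrite -(ltr_nat R) natrM -ltr_pdivlMr.
have [t'n nt' n_gt0] : [/\ (t' <= n)%N, (t' < n - t')%N & (0 < n)%N].
  by move: t'n2; clear; split; lia.
(* A coalition of exactly [t'] members is allowed, as [t' <= t], and is outnumbered by the honest
   participants. *)
have [T hT] := exists_set_card t'n.
have hTC : #|~: T| = (n - t')%N by rewrite cardsCs setCK card_ord hT.
have [j0 hj0] : exists j, j \in ~: T.
  by apply/card_gt0P; rewrite hTC; apply: leq_ltn_trans nt'.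
have hj0' : j0 \notin T by rewrite inE in hj0.
set a := t'%:R / (n%:R - t'%:R) * (1 - delta') in hgap.
set b := t'%:R / n%:R * (1 + delta'') * (1 + s) in hgap.
have n0 : 0 < n%:R :> R by rewrite ltr0n.
have q0 : 0 < q%:R :> R by rewrite ltr0n.
have t0 : 0 < t'%:R :> R by rewrite ltr0n.
have s0 : 0 < s by rewrite !mulr_gt0.
have b0 : 0 < b by rewrite !mulr_gt0 ?invr_gt0 ?addr_gt0.
have a0 : 0 <= a by have := b0; lra.
have p01 : 0 <= p <= 1 by rewrite ltW.
have p01' : 0 < p <= 1 by rewrite p_gt0.
have hm : (0 < q * #|T| < q * #|~: T|)%N.
  by rewrite hT hTC muln_gt0 q_gt0 t'_gt0 ltn_pmul2l.
have aE : a = (q * #|T|)%:R / (q * #|~: T|)%:R * (1 - delta').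
  rewrite /a hT hTC !natrM natrB //.
  by rewrite -mulf_div divff ?gt_eqF // mul1r.
have [c1 c1_gt0 []] := attack_drift p01' delta'_bounds hm.
rewrite -aE; set mu := p * (q * #|T|)%:R.
set D := 1 + 2 * _ / _ => hc1 hc1'.
have mu0 : 0 < mu by case/andP: hm => h _; rewrite mulr_gt0 // ltr0n.
have d0 : 0 < delta' by case/andP: delta'_bounds.
have D1 : 1 <= D.
  by rewrite lerDl divr_ge0 ?(ltW d0) // mulr_ge0 // addr_ge0 // ltW.
clearbody D.
(* [1 - (1 - p) ^+ (q * n)] is at least [s / (1 + s)], whose denominator cancels the factor [1 + s]
   of [b]; and [mu] is [t' / n * s]. *)
have hc2 : delta'' * mu <= b * (1 - (1 - p) ^+ (q * n)) - mu.
  have := bernoulli_le (q * n) p01; rewrite natrM mulrA -/s => h.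
  have -> : b * (1 - (1 - p) ^+ (q * n)) =
      t'%:R / n%:R * (1 + delta'') * ((1 + s) - (1 - p) ^+ (q * n) * (1 + s)).
    by rewrite /b; ring.
  have -> : delta'' * mu = t'%:R / n%:R * (1 + delta'') * s - mu.
    by rewrite /mu hT natrM /s; field; rewrite gt_eqF.
  rewrite lerD2r ler_wpM2l //; last by lra.
  by rewrite mulr_ge0 ?divr_ge0 ?addr_ge0 ?ltW.
(* A lower bound for the probability that [U <= b] in the honest execution and [U > a] in the
   attack. *)
pose kappa := delta'' * mu / b * (c1 / 2).
have kappa0 : 0 < kappa.
  by apply: mulr_gt0; [apply: divr_gt0 => //; apply: mulr_gt0|apply: divr_gt0].
have hTt : (#|T| <= t)%N by rewrite hT.
(* The exponent 1 is enough, as a failure probability of at least [kappa] is not below [1 / K] for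
   large [K]. *)
have [k0 hk0] := hEVP T _ _ hTt (selfish_ppt R n q)
  (idle_environment_admissible R) 1%N.
(* Beyond [k0], [K] is so large that [D / (K + 1) <= c1 / 2] and [1 / K < kappa]. *)
set K := maxn k0 (maxn (Num.bound (2 * D / c1)) (Num.bound kappa^-1)).
have K1 : 2 * D / c1 < K.+1%:R.
  apply: (lt_trans (archi_boundP _)).
    by rewrite divr_ge0 ?mulr_ge0 ?(ltW c1_gt0) //; lra.
  by rewrite ltr_nat ltnS /K !leq_max leqnn orbT.
have K2 : kappa^-1 < K%:R.
  apply: (lt_le_trans (archi_boundP _)); first by rewrite invr_ge0 ltW.
  by rewrite ler_nat /K !leq_max leqnn !orbT.
have K0 : 0 < K.+1%:R :> R by rewrite ltr0n.
have {hk0} := hk0 K (leq_maxl _ _).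
set good := (fun e : outcome n * outcome n => _).
set U := relative_rewards w T j0.
have h1 := attains_compliance idle_environment K p01 hc2.
have h2 := attains_attack idle_environment K p01 D1 hc1 hc1'.
(* [b L - N] is at most [b (K + 1)] times the indicator, and [K + 1] is the number of rounds. *)
have {}h1 : attains (fun o u => u <= (U o <= b)%R%:R)
    (execution p idle_environment (follow R T) T
       ([ffun=> ord0] : {ffun 'I_n -> 'I_q.+1}) K) (delta'' * mu / b).
  have bK : 0 < b * K.+1%:R by rewrite mulr_gt0.
  have -> : delta'' * mu / b =
      (b * K.+1%:R)^-1 * (delta'' * mu * K.+1%:R) + 0.
    move: K.+1%:R K0 => r r0.
    by field; rewrite !gt_eqF.
  apply: attains_mono (attains_affine 0 _ h1); last by rewrite invr_ge0 ltW.
  move=> o _ [x -> [C [hC hs hx]]]; rewrite addr0 mulrC ler_pdivrMr //.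
  rewrite -(hC _ hj0') in hs hx; apply: (le_trans hx).
  apply: (le_trans (relative_rewards_le T w_gt0 j0 o (ltW b0))).
  rewrite mulrC ler_wpM2l ?ler0n // ler_wpM2l ?(ltW b0) // ler_nat //.
(* [N - a L] is at most [K + 1] times the indicator; after division by [K + 1] the summand [D] costs
   at most [c1 / 2]. *)
have {}h2 : attains (fun o u => u <= (a < U o)%R%:R)
    (execution p idle_environment (adv_strategy R (selfish_adversary n q)) T
       (adv_idle (selfish_adversary n q)) K) (c1 / 2).
  apply: (attains_le (v := K.+1%:R^-1 * (c1 * K.+1%:R) + - D / K.+1%:R)).
    rewrite mulrCA mulVf ?gt_eqF // mulr1 mulNr.
    rewrite lerBrDr -lerBrDl; apply: (le_trans (y := c1 / 2)); last by lra.
    rewrite ler_pdivrMr //; move: K1; rewrite ltr_pdivrMr //.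
    by move: K.+1%:R => r; lra.
  apply: attains_mono (attains_affine _ _ h2); last by rewrite invr_ge0 ltW.
  move=> o _ [x -> [C [hC hs hx]]]; rewrite mulrC -mulrDl ler_pdivrMr //.
  rewrite -(hC _ hj0') in hs hx.
  have := relative_rewards_gt T w_gt0 j0 o a0; rewrite -/(U o) => h.
  apply: (le_trans (y := (size (o j0))%:R * (a < U o)%R%:R)); first lra.
  by rewrite mulrC ler_wpM2l ?ler0n // ler_nat.
have hU0 j o : 0 <= relative_rewards w T j o by apply: relative_rewards_ge0.
have hU1 j o : relative_rewards w T j o <= 1 by apply: relative_rewards_le1.
(* The minimum lies between 0 and 1 and is at most [b], so the right-hand side is at most
   [b + eps + eps'], which is less than [a]. *)
have hbad o1 o2 : U o1 <= b -> a < U o2 -> ~~ good (o1, o2).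
  rewrite /good /= -ltNge => hb ha.
  have M := max_over_ge (relative_rewards w T ^~ o2) hj0.
  have N := min_over_le (relative_rewards w T ^~ o1) hj0.
  have N0 := min_over_ge0 (~: T) (hU0 ^~ o1).
  rewrite ger0_norm //; apply: lt_le_trans M.
  apply: le_lt_trans (ha).
  move: N N0; move: (min_over _ _) => x N N0.
  have hx1 : x <= 1 by apply: le_trans N (hU1 _ _).
  have : 0 <= eps * (1 - x) by rewrite mulr_ge0 // subr_ge0.
  by move: hb N hgap; rewrite /U; lra.
have c20 : 0 <= c1 / 2 by lra.
have := attains_independent (E := fun e => ~~ good e) hbad c20 h1 h2.
rewrite (pr_predC good) => hpr.
rewrite expr1 ger0_norm; last by apply: le_trans hpr; apply: ltW.
apply/negP; rewrite -leNgt; apply: le_trans hpr.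
rewrite -[leRHS]invrK lef_pV2 ?posrE ?invr_gt0 //; first exact: ltW.
by apply: lt_trans K2; rewrite invr_gt0.
Qed.
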